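(* Let $d\ge1$, $a,r\in[0,1]$, $\omega\ge0$ with $\omega\in L^1(\mathbb{R}^d)\cap L^\infty(\mathbb{R}^d)$, and let $(\phi_t)_{t\ge0}$, $\phi_t=(X_t)_\#\phi_0$, be a global Lagrangian solution (with $\phi_0$ a probability density in $L^\infty$) of $$\partial_t\phi_t=\operatorname{div}\bigl(\phi_t(K_a*\omega-K_r*\phi_t)\bigr)$$ for which the energy dissipation identity $\frac{d}{dt}\mathcal{E}(\phi_t)=-\int|K_a*\omega-K_r*\phi_t|^2\,d\phi_t$ is valid. Assume: - $\inf\mathcal{E}>-\infty$; - there is $q>\max\{a,r\}$ with $\sup_{t\ge0}\int|x|^q\,d\phi_t(x)<\infty$ and $\int|x|^q\omega(x)\,dx<\infty$; - there is $R_*<\infty$ with $\operatorname{supp}\phi_t\subset B_{R_*}(0)$ for all $t\ge0$; - $\int|x|^a\omega(x)\,dx<\infty$; - if $r=0$, $\sup_{t\ge0}\|\phi_t\|_{L^\infty}<\infty$. Then every omega-limit point of $(\phi_t)$ is a zero-flux stationary state. If there is only one zero-flux stationary state in the omega-limit set, say $\bar\phi$, then $$\phi_t\rightharpoonup\bar\phi\quad\text{narrowly as }t\to\infty .$$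
   Context: For $s\in[0,1]$: $\psi_s(x)=|x|^{1+s}$, $K_s(x)=\nabla\psi_s(x)=(1+s)|x|^{s-1}x$ for $x\ne0$, $K_s(0)=0$. Energy: $$\mathcal{E}(\phi)=\int(\psi_a*\omega)\,d\phi-\frac12\iint\psi_r(x-y)\,d\phi(x)\,d\phi(y),$$ and $\inf\mathcal{E}$ is the infimum over probability measures (for which $\mathcal{E}$ is defined). Lagrangian solution: $\phi_t=(X_t)_\#\phi_0$ with $\dot X_t(x)=-(K_a*\omega)(X_t(x))+(K_r*\phi_t)(X_t(x))$, $X_0(x)=x$, for $\phi_0$-a.e. $x$; $\phi$ is nonnegative and lies in $L^\infty(0,T;L^1\cap L^\infty)$ for every $T>0$. Zero-flux stationary state: probability measure $\mu$ with $\int\xi\cdot(K_a*\omega-K_r*\mu)\,d\mu=0$ for all $\xi\in C_c^\infty(\mathbb{R}^d;\mathbb{R}^d)$. Omega-limit set: the set of $\mu\in\mathcal{P}(\mathbb{R}^d)$ for which there is a sequence $t_k\to\infty$ with $\phi_{t_k}\rightharpoonup\mu$ narrowly; its elements are the omega-limit points. *)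

(* Defs.v *)
From HB Require Import structures.
From mathcomp Require Import all_boot all_order all_algebra.
From mathcomp Require Import all_classical all_reals all_analysis.

Set Implicit Arguments.
Unset Strict Implicit.
Unset Printing Implicit Defensive.

Import Order.TTheory GRing.Theory Num.Theory.
Import numFieldNormedType.Exports.

Local Open Scope classical_set_scope.
Local Open Scope ring_scope.

(* 'rV[R]_d carries its Borel sigma-algebra. Its library norm is the sup norm;
   the Euclidean norm is [enorm] below, and both induce the same topology. *)
HB.instance Definition _ (R : realType) (d : nat) :=
  @isMeasurable.Build (sigma_display (@open 'rV[R]_d)) 'rV[R]_d
    <<s (@open 'rV[R]_d) >> (@sigma_algebra0 _ setT _) (@sigma_algebraC _ _)
    (@sigma_algebra_bigcup _ setT _).

Section borel_rV.
Context {R : realType}.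

Lemma open_rV_measurable d (U : set 'rV[R]_d) : open U -> measurable U.
Proof. exact: sub_sigma_algebra. Qed.

Lemma measurable_coord_rV d (i : 'I_d) :
  measurable_fun setT (fun x : 'rV[R]_d => x 0 i).
Proof.
apply: (measurability _ (measurable_realfun.RGenOpens.measurableE R)).
move=> _ [_ [a [b ->]] <-]; rewrite setTI; apply: open_rV_measurable.
by apply: open_comp => [x _|]; [exact: coord_continuous|exact: interval_open].
Qed.

Lemma measurable_fun_rV dT (T : measurableType dT) d (f : T -> 'rV[R]_d) :
  (forall i, measurable_fun setT (fun t => f t 0 i)) -> measurable_fun setT f.
Proof.
move=> mf; apply: (measurability (@open 'rV[R]_d)) => // _ [U oU <-].
rewrite setTI.
pose B (p : 'rV[rat]_d * nat) : set 'rV[R]_d :=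
  [set x | forall i, ball (ratr (p.1 0 i) : R) p.2.+1%:R^-1 (x 0 i)].
have -> : f @^-1` U = \bigcup_p (if `[< B p `<=` U >] then f @^-1` B p else set0).
  apply/seteqP; split=> [t /= Ut|t [p _]]; last first.
    by case: ifPn => // /asboolP BU /BU.
  have /nbhs_ballP[e /= e0 eU] : nbhs (f t) U by exact: open_nbhs_nbhs.
  have [n ne] : exists n, n.+1%:R^-1 < e / 2.
    have [n _ /(_ n (leqnn n))] :=
      near_infty_natSinv_lt (PosNum (divr_gt0 e0 (ltr0n R 2))).
    by exists n.
  have n0 : 0 < n.+1%:R^-1 :> R by rewrite invr_gt0.
  have /choice[q Hq] i : exists q : rat, ball (f t 0 i) n.+1%:R^-1 (ratr q).
    have Bne : ball (f t 0 i) n.+1%:R^-1 !=set0.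
      by exists (f t 0 i); exact: ballxx.
    have [y [/= By [q _ qy]]] := @dense_rat R _ Bne (ball_open _ _).
    by exists q; rewrite qy.
  have Bft : B (\row_i q i, n) (f t) by move=> i /=; rewrite mxE; exact: ball_sym.
  exists (\row_i q i, n) => //; rewrite asboolT// => x Bx; apply: eU.
  split=> // i j; rewrite (ord1 i).
  rewrite [e]splitr; apply: (ball_triangle (y := (ratr (q j) : R))).
    by apply: le_ball (Hq j); exact: ltW.
  by have := Bx j; rewrite /= mxE; apply: le_ball; exact: ltW.
apply: countable_bigcupT_measurable => // p; case: ifPn => // _.
have -> : f @^-1` B p =
    \bigcap_(i in [set: 'I_d]) ((fun t => f t 0 i) @^-1`
      ball (ratr (p.1 0 i) : R) p.2.+1%:R^-1).
  by apply/seteqP; split=> t /= Bt; [move=> i _|move=> i]; exact: Bt.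
apply: fin_bigcap_measurable => // i _; rewrite -[X in measurable X]setTI.
by apply: mf => //; exact: measurable_realfun.measurable_ball.
Qed.

End borel_rV.

Section lebesgue_rV.
Context {R : realType}.

Definition rV_cons d (p : 'rV[R]_d * measurableTypeR R) : 'rV[R]_d.+1 :=
  \row_i oapp (fun j => p.1 0 j) p.2 (unlift ord0 i).

Lemma measurable_rV_cons d : measurable_fun setT (@rV_cons d).
Proof.
apply: measurable_fun_rV => i /=; under eq_fun do rewrite mxE.
case: unliftP => [j _|_] /=; last exact: measurable_snd.
by apply: (measurableT_comp (measurable_coord_rV j)); exact: measurable_fst.
Qed.

Section step.
Context d (m : {measure set 'rV[R]_d -> \bar R}).

Definition lebesgue_rV_step : set 'rV[R]_d.+1 -> \bar R :=
  pushforward (m \x lebesgue_measure)%E (@rV_cons d).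

Let step0 : lebesgue_rV_step set0 = 0%E.
Proof. by rewrite /lebesgue_rV_step /pushforward preimage_set0 measure0. Qed.

Let step_ge0 A : (0 <= lebesgue_rV_step A)%E.
Proof. by rewrite /lebesgue_rV_step /pushforward measure_ge0. Qed.

Let step_sigma_additive : semi_sigma_additive lebesgue_rV_step.
Proof.
have mc A : measurable A -> measurable (@rV_cons d @^-1` A).
  by move=> mA; rewrite -[X in measurable X]setTI; exact: measurable_rV_cons.
move=> F mF tF mUF; rewrite /lebesgue_rV_step /pushforward preimage_bigcup.
apply: measure_semi_sigma_additive => [n||]; first exact: mc.
- apply/trivIsetP => i j _ _ ij; rewrite -preimage_setI.
  by move/trivIsetP : tF => /(_ _ _ _ _ ij) ->//; rewrite preimage_set0.
- by rewrite -preimage_bigcup; exact: mc.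
Qed.

HB.instance Definition _ := isMeasure.Build _ _ _ lebesgue_rV_step
  step0 step_ge0 step_sigma_additive.

End step.

Fixpoint lebesgue_rV d : {measure set 'rV[R]_d -> \bar R} :=
  match d return {measure set 'rV[R]_d -> \bar R} with
  | 0 => dirac (0 : 'rV[R]_0)
  | d'.+1 => lebesgue_rV_step (lebesgue_rV d')
  end.

Lemma lebesgue_rV_box d (A : 'I_d -> set R) : (forall i, measurable (A i)) ->
  lebesgue_rV d [set x | forall i, A i (x 0 i)] =
  (\prod_(i < d) lebesgue_measure (A i))%E.
Proof.
elim: d A => [|d IH] A mA /=.
  rewrite big_ord0 diracE mem_set//=; last by case.
rewrite big_ord_recl muleC -(IH (fun i => A (lift ord0 i)))//.
set B := [set x : 'rV[R]_d | forall i, A (lift ord0 i) (x 0 i)].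
have BE : B = \bigcap_(i in [set: 'I_d]) ((fun x : 'rV[R]_d => x 0 i) @^-1`
    A (lift ord0 i)).
  by apply/seteqP; split=> t /= At; [move=> i _|move=> i]; exact: At.
have mB : measurable B.
  rewrite BE; apply: fin_bigcap_measurable => // i _.
  by rewrite -[X in measurable X]setTI; exact: measurable_coord_rV.
rewrite /lebesgue_rV_step /pushforward -product_measure1E//; last exact: mA.
congr (_ _); apply/seteqP; split=> -[x y] /=.
  move=> H; split=> [i|].
    by have := H (lift ord0 i); rewrite mxE liftK.
  by have := H ord0; rewrite mxE unlift_none.
by move=> [Hx Hy] i; rewrite mxE; case: unliftP => [j ->|->].
Qed.

End lebesgue_rV.

Section euclidean.
Context {R : realType} {d : nat}.
Implicit Types x y : 'rV[R]_d.

Definition dotv x y : R := \sum_i x 0 i * y 0 i.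

Definition enorm x : R := Num.sqrt (dotv x x).

Definition msupport (mu : {measure set 'rV[R]_d -> \bar R}) : set 'rV[R]_d :=
  [set x | forall U, open_nbhs x U -> (0 < mu U)%E].

Definition is_density (mu : {measure set 'rV[R]_d -> \bar R})
    (f : 'rV[R]_d -> R) : Prop :=
  [/\ measurable_fun setT f, forall x, 0 <= f x &
      forall A, measurable A ->
        mu A = (\int[lebesgue_rV d]_(x in A) (f x)%:E)%E].

Definition narrow_cvg {I : Type} (F : set_system I)
    (nu : I -> probability 'rV[R]_d R) (mu : probability 'rV[R]_d R) : Prop :=
  forall f : 'rV[R]_d -> R, continuous f ->
    (exists M : R, forall x, `|f x| <= M) ->
    (\int[nu i]_x f x) @[i --> F] --> \int[mu]_x f x.

Fixpoint Ck (k : nat) (f : 'rV[R]_d -> 'rV[R]_d) : Prop :=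
  continuous f /\
  if k is k'.+1 then
    forall i : 'I_d, (forall x, derivable f x (delta_mx 0 i)) /\
                     Ck k' (fun x => 'D_(delta_mx 0 i) f x)
  else True.

Definition test_field (xi : 'rV[R]_d -> 'rV[R]_d) : Prop :=
  (forall k, Ck k xi) /\ compact (closure [set x | xi x != 0]).

End euclidean.

Section interaction.
Context {R : realType} {d : nat}.
Implicit Types (s a r t : R) (x y : 'rV[R]_d) (omega : 'rV[R]_d -> R).
Implicit Types (mu : probability 'rV[R]_d R).

Definition psi s x : R := enorm x `^ (1 + s).

Definition kern s x : 'rV[R]_d :=
  if x == 0 then 0 else ((1 + s) * enorm x `^ (s - 1)) *: x.

Definition psi_conv s omega x : \bar R :=
  (\int[lebesgue_rV d]_y (psi s (x - y) * omega y)%:E)%E.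

Definition kern_conv s omega x : 'rV[R]_d :=
  \row_i \int[lebesgue_rV d]_y (kern s (x - y) 0 i * omega y).

Definition kern_mconv s mu x : 'rV[R]_d :=
  \row_i \int[mu]_y kern s (x - y) 0 i.

Definition flux a r omega mu x : 'rV[R]_d :=
  kern_conv a omega x - kern_mconv r mu x.

Definition attraction_energy a omega mu : \bar R :=
  (\int[mu]_x psi_conv a omega x)%E.

Definition repulsion_energy r mu : \bar R :=
  (\int[mu]_x \int[mu]_y (psi r (x - y))%:E)%E.

Definition energy a r omega mu : \bar R :=
  (attraction_energy a omega mu - 2^-1%:E * repulsion_energy r mu)%E.

(* Excludes the indeterminate form +oo - +oo, to which the library gives the
   value -oo. *)
Definition energy_defined a r omega mu : Prop :=
  ~ (attraction_energy a omega mu = +oo%E /\ repulsion_energy r mu = +oo%E).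

(* The velocity is continuous in time, so differentiability on ]0, +oo[ with
   continuity on [0, +oo[ includes the right derivative at 0. *)
Record lagrangian_solution a r omega (phi : R -> probability 'rV[R]_d R)
    (rho : R -> 'rV[R]_d -> R) (X : R -> 'rV[R]_d -> 'rV[R]_d) : Prop := {
  lagrangian_density : forall t, 0 <= t -> is_density (phi t) (rho t) ;
  lagrangian_initial_bounded : rho 0 \in Lfun (lebesgue_rV d) +oo%E ;
  lagrangian_density_measurable :
    measurable_fun (@setX R 'rV[R]_d `]0, +oo[ setT) (fun p : R * 'rV[R]_d => rho p.1 p.2) ;
  lagrangian_density_bounded : forall T : R, 0 < T -> exists M : R,
    {ae lebesgue_measure, forall t : R, 0 < t < T ->
      ('N[lebesgue_rV d]_1 [EFin \o rho t] <= M%:E)%E /\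
      ('N[lebesgue_rV d]_+oo [EFin \o rho t] <= M%:E)%E} ;
  lagrangian_flow_measurable : forall t, 0 <= t -> measurable_fun setT (X t) ;
  lagrangian_pushforward : forall t, 0 <= t -> forall A, measurable A ->
    phi t A = pushforward (phi 0) (X t) A ;
  lagrangian_ode : {ae phi 0, forall x,
    [/\ X 0 x = x,
        {within `[0, +oo[, continuous (X ^~ x)} &
        forall t, 0 < t -> is_derive t 1 (X ^~ x)
          (- kern_conv a omega (X t x) + kern_mconv r (phi t) (X t x))]} }.

Definition energy_dissipation a r omega (phi : R -> probability 'rV[R]_d R) :
    Prop :=
  (forall t, 0 <= t -> energy a r omega (phi t) \is a fin_num) /\
  (forall t, 0 < t -> is_derive t 1 (fun s => fine (energy a r omega (phi s)))
    (- \int[phi t]_x (enorm (flux a r omega (phi t) x) ^+ 2))).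

(* The first clause asks that K_r * mu converge: an integral that does not
   converge has a default value in the library. The equation in the second
   clause is one of extended reals, so it also says that the integral is
   finite. *)
Definition zero_flux_stationary a r omega mu : Prop :=
  (forall x i, mu.-integrable setT (fun y => (kern r (x - y) 0 i)%:E)) /\
  (forall xi, test_field xi ->
    (\int[mu]_x (dotv (xi x) (flux a r omega mu x))%:E = 0)%E).

Definition omega_limit (phi : R -> probability 'rV[R]_d R) mu : Prop :=
  exists t_ : nat -> R, t_ @ \oo --> +oo /\ narrow_cvg \oo (phi \o t_) mu.

End interaction.

(* Main.v *)
Require Import Defs.
From HB Require Import structures.
From mathcomp Require Import all_boot all_order all_algebra.
From mathcomp Require Import all_classical all_reals all_analysis.
From mathcomp Require Import measurable_realfun ess_sup_inf lra ring.

Set Implicit Arguments.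
Unset Strict Implicit.
Unset Printing Implicit Defensive.

Import Order.TTheory GRing.Theory Num.Theory.
Import numFieldNormedType.Exports.

Local Open Scope classical_set_scope.
Local Open Scope ring_scope.

(* Dissipated energy is bounded, so by the mean value theorem any times t_n
   tending to infinity admit times s_n close to t_n at which the dissipation
   tends to 0; the velocities being bounded, the two sequences of measures have
   the same narrow limit mu. The fluxes at the times s_n converge uniformly on
   the common ball of support to the flux of mu (for r = 0 the jump of the
   kernel at the origin is negligible because the densities are bounded), hence
   the flux of mu vanishes mu-almost everywhere. Convergence of the whole curve
   follows by compactness of the measures carried by a fixed ball, which is
   obtained on the line from Helly's theorem for quantile functions and
   transported to space along Schoenberg's space-filling curve. *)

(** * Selection theorems on the line *)

(** A lower bound on the energy makes the dissipation small only at well-chosen times, not at given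
    ones; hence the second sequence of times, and the role of the common ball, on which both
    convolutions and therefore the velocity are bounded. In the dissipation at time s_n the measure
    and the integrand vary together, whereas narrow convergence tests a fixed continuous function;
    uniform convergence of the fluxes removes this double dependence. For r = 0 the kernel x/|x| is
    regularised at a small scale, and the error is controlled by the mass of small balls, uniformly
    in n and in the limit. Compactness rests on an asymmetry: a cube is encoded in the unit interval
    by a map that is only measurable, and decoded by a continuous one. Measurability suffices to
    transport laws, continuity of the decoding to transport almost sure convergence; the limit
    measure is the law of the decoded limit variable. *)

Section extraction.
Context {R : realType}.

(** Tychonoff's theorem provides a cluster point [L] of the rows; choosing [s k] to match [L] on the
    first [k + 1] coordinates up to [1/(k + 1)] performs the diagonal extraction in one stroke. The
    bound [k <= s k] makes [s] cofinal without making it increasing, which is all that limits along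
    [s] require. *)
Lemma bounded_sequences_subsequence (u : nat -> nat -> R) :
  (forall k j, 0 <= u k j <= 1) ->
  exists (s : nat -> nat) (L : nat -> R),
    (forall k, (k <= s k)%N) /\ forall j, u (s k) j @[k --> \oo] --> L j.
Proof.
move=> u01; pose T := prod_topology (fun _ : nat => R).
have cA : compact [set f : T | forall i, `[0, 1]%classic (f i)].
  apply: (@tychonoff nat (fun=> R) (fun=> `[0, 1]%classic)) => i.
  exact: segment_compact.
pose F : set_system T := u @ \oo.
have FF : ProperFilter F by exact: fmap_proper_filter.
have FA : F [set f : T | forall i, `[0, 1]%classic (f i)].
  by exists 0%N => // k _ i /=; rewrite in_itv/= u01.
have [L [_ cL]] := cA F FF FA.
have /choice[s Hs] : forall k : nat, exists m, (k <= m)%N /\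
    forall j, (j < k.+1)%N -> `|L j - u m j| < k.+1%:R^-1.
  move=> k.
  have nL n : nbhs (L : T)
      [set f : T | forall j, (j < n)%N -> `|L j - f j| < k.+1%:R^-1].
    elim: n => [|n IH]; first by apply: filterS (@filterT _ (nbhs (L : T)) _) => f.
    have pn : nbhs (L : T) [set f : T | `|L n - f n| < k.+1%:R^-1].
      apply: (@proj_continuous nat (fun _ : nat => R) n L
        [set y | `|L n - y| < k.+1%:R^-1]).
      by apply: (@nbhsx_ballx _ R (L n)); rewrite invr_gt0.
    apply: filterS2 pn IH => f fn fj j.
    by rewrite ltnS leq_eqVlt => /orP[/eqP ->//|]; exact: fj.
  have Fk : F [set f | exists m, (k <= m)%N /\ f = u m].
    by exists k => // m /= km; exists m.
  have [f [[m [km ->]] Hf]] := cL _ _ Fk (nL k.+1).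
  by exists m.
exists s, L; split=> [k|j]; first by case: (Hs k).
apply/cvgrPdist_lt => e e0.
near=> k.
have [_ /(_ j) H] := Hs k.
apply: (lt_le_trans (H _)).
  by rewrite ltnS; near: k; exists j.
apply/ltW; near: k; exact: near_infty_natSinv_lt (PosNum e0).
Unshelve. all: by end_near. Qed.

End extraction.

(** * Quantile functions and the uniform law *)

Section quantile.
Context {R : realType}.
Local Notation leb := (@lebesgue_measure R).

Lemma probability_eq_rays (m1 m2 : probability (measurableTypeR R) R) :
  (forall c : R, m1 `]-oo, c]%classic = m2 `]-oo, c]%classic) ->
  forall A, measurable A -> m1 A = m2 A.
Proof.
move=> m12 A mA.
apply: (@measure_unique _ R (measurableTypeR R) (@ocitv R)
  (fun n => `]- n%:R, n%:R]%classic)) => //.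
- exact: ocitvI.
- move=> n; exact: is_ocitv.
- by rewrite bigcup_itvT.
- move=> _ [[a b] _ <-] /=.
  have [ab|ba] := leP a b; last first.
    by rewrite set_itv_ge ?measure0// bnd_simp -leNgt ltW.
  have -> : `]a, b]%classic = `]-oo, b] `\` `]-oo, a].
    by rewrite -[RHS]setCK setCD setCitvl setUC -[LHS]setCK setCitv.
  rewrite !measureD ?setIidr//; try exact: subset_itvl.
  + by congr (_ - _)%E; exact: m12.
  + by rewrite -ge0_fin_numE// fin_num_measure.
  + by rewrite -ge0_fin_numE// fin_num_measure.
- by move=> k; rewrite -ge0_fin_numE// fin_num_measure.
Qed.

(** The interval is open because the quantile at 0 of a nonnegative function would be the infimum of
    the whole line; the law is kept on all of the line so that quantile functions may be total. *)
Definition uniform01 : set (measurableTypeR R) -> \bar R :=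
  mrestr leb (measurable_itv `]0, 1[).

HB.instance Definition _ := Measure.on uniform01.

Let uniform01_setT : uniform01 setT = 1%E.
Proof.
by rewrite /uniform01 /mrestr setTI lebesgue_measure_itv/= lte01 oppr0 adde0.
Qed.

HB.instance Definition _ := Measure_isProbability.Build _ _ _ uniform01
  uniform01_setT.

Definition quantile (F : R -> R) (u : R) : R := inf [set c | u <= F c].

Section quantile_le.
Variable F : R -> R.
Hypothesis F_nd : {homo F : x y / x <= y}.
Hypothesis F_rc : right_continuous F.
Hypothesis F0 : forall c : R, c < 0 -> F c = 0.
Hypothesis F1 : F 1 = 1.

(** Galois connection between [F] and its quantile function. Right continuity puts the infimum into
    [S]: if [F c < u], then [F] stays below [u] slightly to the right of [c]. Positivity of [u] and
    [F0] bound [S] below, [F1] makes it nonempty. *)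
Lemma quantile_le (u c : R) : 0 < u <= 1 -> (quantile F u <= c) = (u <= F c).
Proof.
move=> /andP[u0 u1]; set S := [set c | u <= F c].
have lS : lbound S 0.
  move=> x Sx; rewrite leNgt; apply/negP => /F0 Fx0.
  by move: Sx; rewrite /S/= Fx0 leNgt u0.
have iS : has_inf S by split; [exists 1; rewrite /S/= F1|exists 0].
apply/idP/idP => [Qc|]; last by move=> Sc; apply: ge_inf => //; case: iS.
rewrite leNgt; apply/negP => Fcu.
have H := (cvgr_lt _ (@F_rc c)) _ Fcu.
have [c' [cc' Fc']] : exists c', c < c' /\ F c' < u.
  have [e /= e0 He] := H.
  exists (c + e / 2); split; first by rewrite ltrDl divr_gt0.
  apply: He; last by rewrite ltrDl divr_gt0.
  rewrite /= opprD addNKr normrN gtr0_norm ?divr_gt0//.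
  by rewrite ltr_pdivrMr// ltr_pMr// ltr1n.
have [s Ss sc'] : exists2 s, S s & s < c'.
  have [s Ss] := inf_adherent (ltr01 : 0 < (1:R)) iS => _.
  apply/not_exists2P => H'.
  suff : c' <= inf S by rewrite leNgt (le_lt_trans Qc).
  by apply: lb_le_inf => [|x Sx]; [exists s|rewrite leNgt; apply/negP; case: (H' x)].
by move: Fc'; rewrite ltNge (le_trans Ss)// F_nd// ltW.
Qed.

Lemma quantile_bounds (u : R) : 0 < u <= 1 -> 0 <= quantile F u <= 1.
Proof.
move=> u01; apply/andP; split; last by rewrite quantile_le// F1; case/andP: u01.
rewrite leNgt; apply/negP => Q0.
have := lexx (quantile F u); rewrite quantile_le// F0//.
by case/andP: u01 => u0 _; rewrite leNgt u0.
Qed.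

Lemma quantile_nd (u v : R) : 0 < u -> u <= v -> v <= 1 ->
  quantile F u <= quantile F v.
Proof.
move=> u0 uv v1.
have v01 : 0 < v <= 1 by rewrite v1 (lt_le_trans u0).
have u01 : 0 < u <= 1 by rewrite u0 (le_trans uv).
by rewrite quantile_le//; apply: (le_trans uv); rewrite -quantile_le.
Qed.

End quantile_le.
End quantile.

Section helly.
Context {R : realType}.

(* Off the jumps of the limit, which sit over disjoint intervals and so inject
   into the rationals, monotonicity squeezes the functions between their limits
   at nearby rationals. *)
Lemma helly_selection (Q : nat -> R -> R) :
  (forall k, {homo Q k : x y / x <= y}) -> (forall k u, 0 <= Q k u <= 1) ->
  exists (s : nat -> nat) (G : R -> R), [/\ forall k, (k <= s k)%N,
    {homo G : x y / x <= y} &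
    exists2 D, countable D &
      forall u, ~ D u -> Q (s k) u @[k --> \oo] --> G u].
Proof.
move=> Qnd Q01.
pose qn (j : nat) : rat := odflt 0 (unpickle j).
have [s [L [sk sL]]] := @bounded_sequences_subsequence R
  (fun k j => Q k (ratr (qn j))) (fun k j => Q01 k _).
pose l (q : rat) := L (pickle q).
have ll q : Q (s k) (ratr q) @[k --> \oo] --> l q.
  by have := sL (pickle q); rewrite /qn pickleK.
have l01 q : 0 <= l q <= 1.
  apply/andP; split.
    apply: (cvgr_to_ge (ll q)); apply: nearW => k.
    by case/andP: (Q01 (s k) (ratr q)).
  apply: (cvgr_to_le (ll q)); apply: nearW => k.
  by case/andP: (Q01 (s k) (ratr q)).
have l_nd (p q : rat) : p <= q -> l p <= l q.
  move=> pq; apply: (ler_cvg_to (ll p) (ll q)); apply: nearW => k.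
  by apply: Qnd; rewrite ler_rat.
have ratP (x y : R) : x < y -> exists q : rat, x < ratr q < y.
  by move=> /rat_in_itvoo[q]; rewrite in_itv/=; exists q.
pose A (u : R) := [set l q | q in [set q : rat | ratr q < u]].
pose B (u : R) := [set l q | q in [set q : rat | u < ratr q]].
have supA (u : R) : has_sup (A u).
  split; last by exists 1 => _ [q _ <-]; case/andP: (l01 q).
  have [q /andP[_ qu]] : exists q : rat, u - 1 < ratr q < u.
    by apply: ratP; rewrite ltrBlDr ltrDl.
  by exists (l q); exists q.
have infB (u : R) : has_inf (B u).
  split; last by exists 0 => _ [q _ <-]; case/andP: (l01 q).
  have [q /andP[uq _]] : exists q : rat, u < ratr q < u + 1.
    by apply: ratP; rewrite ltrDl.
  by exists (l q); exists q.
exists s, (fun u => sup (A u)); split => //.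
  move=> x y xy; apply: ge_sup; first by case: (supA x).
  move=> _ [q /= qx <-]; apply: ub_le_sup; first by case: (supA y).
  by exists q => //=; exact: lt_le_trans xy.
exists [set u | sup (A u) < inf (B u)].
  have /choice[c Hc] (u : R) : exists q : rat,
      sup (A u) < inf (B u) -> sup (A u) < ratr q < inf (B u).
    have [ab|ab] := ltP (sup (A u)) (inf (B u)); last by exists 0.
    by have [q Hq] := ratP _ _ ab; exists q.
  apply/countable_injP; exists (pickle \o c) => u v.
  rewrite !inE /= => uD vD /(pcan_inj pickleK) cuv.
  have sep (x y : R) : sup (A x) < inf (B x) -> sup (A y) < inf (B y) ->
      x < y -> c x = c y -> False.
    move=> /Hc/andP[_ cx] /Hc/andP[cy _] /ratP[p /andP[xp py]] cxy.
    have : (ratr (c x) : R) < ratr (c y).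
      apply: (lt_le_trans cx); apply: (le_trans _ (ltW cy)).
      apply: (@le_trans _ _ (l p)).
        by apply: ge_inf; [case: (infB x)|exists p].
      by apply: ub_le_sup; [case: (supA y)|exists p].
    by rewrite cxy ltxx.
  have [uv|vu|//] := ltgtP u v; exfalso; first exact: sep uD vD uv cuv.
  exact: sep vD uD vu (esym cuv).
move=> u /= /negP; rewrite -leNgt => BA.
apply/cvgrPdist_le => e e0.
have e20 : 0 < e / 2 by rewrite divr_gt0.
have [_ [p /= pu <-] lp] := sup_adherent e20 (supA u).
have [_ [q /= uq <-] lq] := inf_adherent e20 (infB u).
near=> k.
have kp : l p - e / 2 < Q (s k) (ratr p).
  by near: k; apply: (cvgr_gt _ (ll p)); rewrite ltrBlDr ltrDl.
have kq : Q (s k) (ratr q) < l q + e / 2.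
  by near: k; apply: (cvgr_lt _ (ll q)); rewrite ltrDl.
have pQ : Q (s k) (ratr p) <= Q (s k) u by apply: Qnd; exact: ltW.
have qQ : Q (s k) u <= Q (s k) (ratr q) by apply: Qnd; exact: ltW.
rewrite ler_distl; apply/andP; split; lra.
Unshelve. all: by end_near. Qed.

End helly.

Section skorokhod.
Context {R : realType} {d} {T : measurableType d}.
Variables (P : nat -> probability T R) (e : T -> R).
Hypothesis me : measurable_fun setT e.
Hypothesis e01 : forall x, 0 <= e x <= 1.

Let F k c := fine (P k (e @^-1` `]-oo, c])).

Let mray c : measurable (e @^-1` `]-oo, c]).
Proof. by rewrite -[X in measurable X]setTI; exact: me. Qed.

Let FE k c : P k (e @^-1` `]-oo, c]) = (F k c)%:E.
Proof. by rewrite /F fineK// fin_num_measure. Qed.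

Let F_nd k : {homo F k : x y / x <= y}.
Proof.
move=> x y xy; rewrite -lee_fin -!FE le_measure ?inE//.
by apply: preimage_subset; exact: subset_itvl.
Qed.

Let eRV : {mfun T >-> R} := HB.pack_for {mfun T >-> R} e
  (isMeasurableFun.Build _ _ _ _ e me).

Let F_rc k : right_continuous (F k).
Proof.
move=> c; apply: fine_cvg; rewrite fineK ?fin_num_measure//.
exact: (@cdf_right_continuous _ _ _ (P k) eRV c).
Qed.

Let F0 k (c : R) : c < 0 -> F k c = 0.
Proof.
move=> c0; rewrite /F (_ : _ @^-1` _ = set0) ?measure0// -subset0 => x /=.
rewrite in_itv/= => ec; have /andP[+ _] := e01 x.
by rewrite leNgt (le_lt_trans ec).
Qed.

Let F1 k : F k 1 = 1.
Proof.
rewrite /F (_ : _ @^-1` _ = setT) ?probability_setT// -subTset => x _ /=.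
by rewrite in_itv/=; case/andP: (e01 x).
Qed.

Let F01 k c : 0 <= F k c <= 1.
Proof. by rewrite -!lee_fin -FE measure_ge0 probability_le1. Qed.

(** Extension by 0 and 1 outside the unit interval keeps the quantile function monotone on the whole
    line, as [helly_selection] demands; [uniform01] does not see the change. *)
Let Q k (u : R) : R :=
  if u <= 0 then 0 else if 1 <= u then 1 else quantile (F k) u.

Let QE k u : 0 < u < 1 -> Q k u = quantile (F k) u.
Proof. by move=> /andP[u0 u1]; rewrite /Q !leNgt u0 u1. Qed.

Let quantile_leF k u c : 0 < u < 1 -> (quantile (F k) u <= c) = (u <= F k c).
Proof.
move=> /andP[u0 u1]; apply: (quantile_le (@F_nd k) (@F_rc k) (@F0 k) (F1 k)).
by rewrite u0 ltW.
Qed.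

Let quantile01 k u : 0 < u -> u < 1 -> 0 <= quantile (F k) u <= 1.
Proof.
move=> u0 u1; apply: (quantile_bounds (@F_nd k) (@F_rc k) (@F0 k) (F1 k)).
by rewrite u0 ltW.
Qed.

Let Q01 k u : 0 <= Q k u <= 1.
Proof.
rewrite /Q; have [_|u0] := leP u 0; first by rewrite lexx ler01.
by have [_|u1] := leP 1 u; [rewrite lexx ler01|exact: quantile01].
Qed.

Let Q_nd k : {homo Q k : u v / u <= v}.
Proof.
move=> u v uv; have [u0|u0] := leP u 0.
  by rewrite {1}/Q u0; case/andP: (Q01 k v).
have [v1|v1] := leP 1 v.
  by rewrite {2}/Q v1 [v <= 0]leNgt (lt_le_trans u0 uv)/=; case/andP: (Q01 k u).
have u01 : 0 < u < 1 by rewrite u0 (le_lt_trans uv).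
have v01 : 0 < v < 1 by rewrite v1 (lt_le_trans u0).
rewrite !QE//.
by apply: (quantile_nd (@F_nd k) (@F_rc k) (@F0 k) (F1 k)) => //; exact: ltW.
Qed.

Let mQ k : measurable_fun setT (Q k : measurableTypeR R -> R).
Proof. exact: nondecreasing_measurable. Qed.

(** Inverse transform sampling, checked on rays: by [quantile_leF] the preimage of a ray is []0, F k
    c]] cut to []0, 1[]. *)
Let Q_law k A : measurable A -> uniform01 (Q k @^-1` A) = P k (e @^-1` A).
Proof.
move=> mA.
pose QRV : {mfun measurableTypeR R >-> measurableTypeR R} :=
  HB.pack_for {mfun measurableTypeR R >-> measurableTypeR R} (Q k)
  (isMeasurableFun.Build _ _ (measurableTypeR R) (measurableTypeR R) (Q k) (mQ k)).
pose eRV' : {mfun T >-> measurableTypeR R} :=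
  HB.pack_for {mfun T >-> measurableTypeR R} e
  (isMeasurableFun.Build _ _ T (measurableTypeR R) e me).
apply: (probability_eq_rays (m1 := distribution uniform01 QRV)
  (m2 := distribution (P k) eRV')) => // c.
transitivity (F k c)%:E; last exact/esym/FE.
rewrite /distribution /pushforward/= /uniform01 /mrestr.
have /andP[Fc0 Fc1] := F01 k c.
have [Fc|Fc] := ltP (F k c) 1.
  have -> : Q k @^-1` `]-oo, c] `&` `]0, 1[ = `]0, F k c]%classic.
    apply/seteqP; split=> u; rewrite /= !in_itv/=.
      by move=> [Quc /andP[u0 u1]]; rewrite u0 -quantile_leF ?u0// -QE ?u0.
    move=> /andP[u0 uF]; have u1 := le_lt_trans uF Fc.
    by rewrite u0 u1; split => //; rewrite QE ?u0 ?u1// quantile_leF ?u0.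
  rewrite lebesgue_measure_itv/= lte_fin oppr0 adde0; case: ltgtP Fc0 => //.
  by move=> <-.
have -> : Q k @^-1` `]-oo, c] `&` `]0, 1[ = `]0, 1[%classic.
  apply/seteqP; split=> u; rewrite /= !in_itv/=; first by case.
  move=> /andP[u0 u1]; split; last by rewrite u0.
  by rewrite QE ?u0// quantile_leF ?u0// (le_trans (ltW u1)).
rewrite lebesgue_measure_itv/= lte01 oppr0 adde0.
by congr EFin; apply/eqP; rewrite eq_le Fc Fc1.
Qed.

(** Skorokhod's representation for the real variable [e]: the quantile functions realise its laws on
    one probability space, and Helly's exceptional set, being countable, is null for [uniform01]. *)
Lemma skorokhod_subsequence : exists (s : nat -> nat)
    (Y : nat -> measurableTypeR R -> R) (Z : measurableTypeR R -> R),
  [/\ forall k, (k <= s k)%N, forall k, measurable_fun setT (Y k),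
      measurable_fun setT Z,
      forall k A, measurable A -> uniform01 (Y k @^-1` A) = P (s k) (e @^-1` A) &
      {ae uniform01, forall u, Y k u @[k --> \oo] --> Z u}].
Proof.
have [s [G [sk Gnd [D cD QG]]]] := helly_selection Q_nd Q01.
exists s, (fun k => Q (s k)), G; split => // [|k A mA|].
- exact: nondecreasing_measurable.
- exact: Q_law.
- exists D; split.
  + exact: countable_measurable.
  + rewrite /uniform01 /mrestr; apply/eqP; rewrite -measure_le0.
    apply: (@le_trans _ _ (lebesgue_measure D)).
      by apply: measureIl => //; exact: countable_measurable.
    by rewrite countable_lebesgue_measure0.
  + by move=> u /= H; apply: contrapT => Du; exact/H/QG.
Qed.

End skorokhod.

(** * A space-filling curve *)

Lemma cvg_sumr {R : realType} {T : Type} (F : set_system T) {FF : Filter F}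
    (n : nat) (f : 'I_n -> T -> R) (l : 'I_n -> R) :
  (forall i, f i t @[t --> F] --> l i) ->
  \sum_i f i t @[t --> F] --> \sum_i l i.
Proof.
move=> fl; elim: (index_enum _) => [|i s IH].
  by rewrite big_nil; under eq_cvg do rewrite big_nil; exact: cvg_cst.
by rewrite big_cons; under eq_cvg do rewrite big_cons; exact: cvgD.
Qed.

Lemma cvg_rV {R : realType} {T : Type} (F : set_system T) {FF : Filter F}
    (d : nat) (f : T -> 'rV[R]_d) (l : 'rV[R]_d) :
  (forall i, f t 0 i @[t --> F] --> l 0 i) -> f @ F --> l.
Proof.
move=> fl U [V lV VU].
suff : \near F, forall i, V 0 i (f F 0 i).
  by apply: filterS => t Vt; apply: VU => i j; rewrite (ord1 i); exact: Vt.
by apply: filter_forall => i; exact: (fl i).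
Qed.

Lemma coord_le_norm {R : realType} (d : nat) (x : 'rV[R]_d) (i : 'I_d) :
  `|x 0 i| <= `|x|.
Proof.
rewrite [leRHS]mx_normrE.
exact: (le_bigmax _ (fun ij : 'I_1 * 'I_d => `|x ij.1 ij.2|) (0, i)).
Qed.

Definition clamp {R : realType} (a b x : R) : R := Num.max a (Num.min b x).

Lemma clamp_itv {R : realType} (a b x : R) : a <= b -> a <= clamp a b x <= b.
Proof. by move=> ab; rewrite /clamp le_max lexx/= ge_max ab ge_min lexx. Qed.

Lemma clamp_id {R : realType} (a b x : R) : a <= x <= b -> clamp a b x = x.
Proof.
by move=> /andP[ax xb]; rewrite /clamp (min_idPr xb) (max_idPr ax).
Qed.

Lemma continuous_clamp {R : realType} (a b : R) : continuous (clamp a b).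
Proof.
move=> x; apply: (@continuous_max R R (cst a) (fun x => Num.min b x)).
  exact: cst_continuous.
apply: (@continuous_min R R (cst b) id); first exact: cst_continuous.
exact: cvg_id.
Qed.

Section expansion.
Context {R : realType}.
Implicit Types (b : nat -> R) (B y t : R).

Definition partial_expansion B b (n : nat) : R := \sum_(j < n) b j / B ^+ j.+1.

Lemma partial_expansionS B b n :
  partial_expansion B b n.+1 = partial_expansion B b n + b n / B ^+ n.+1.
Proof. by rewrite /partial_expansion big_ord_recr. Qed.

Definition expansion B b : R := limn (partial_expansion B b).

Section bounds.
Variables (B K : R) (b : nat -> R).
Hypotheses (B2 : 2 <= B) (KB : 1 <= K * (B - 1)) (b01 : forall j, 0 <= b j <= 1).

Let B0 : 0 < B. Proof. exact: lt_le_trans B2. Qed.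

Let K0 : 0 <= K.
Proof.
have B1 : 0 < B - 1 by move: B2; lra.
by rewrite -(pmulr_lge0 _ B1) (le_trans ler01).
Qed.

Let BV0 n : 0 <= B ^- n. Proof. by rewrite invr_ge0 exprn_ge0// ltW. Qed.

Let partial_nd : nondecreasing_seq (partial_expansion B b).
Proof.
apply/nondecreasing_seqP => n; rewrite partial_expansionS.
by rewrite lerDl mulr_ge0//; case/andP: (b01 n).
Qed.

(** The geometric tail from [N] to [n] equals [(B^-N - B^-n) / (B - 1)], and [K] is any bound for
    [1 / (B - 1)]. Keeping the term [B^-n] lets the induction on [n] close. *)
Let partial_le N n : (N <= n)%N ->
  partial_expansion B b n <= partial_expansion B b N + K * (B ^- N - B ^- n).
Proof.
move=> /subnK <-; elim: (n - N)%N => [|m IH].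
  by rewrite add0n subrr mulr0 addr0.
rewrite addSn partial_expansionS.
have E : B ^- (m + N) = B * B ^- (m + N).+1.
  by rewrite exprS invfM mulrA divff ?gt_eqF// mul1r.
have z0 := BV0 (m + N).+1; move: IH; rewrite E.
have /andP[_ b1] := b01 (m + N)%N.
move: z0 b1; set z := B ^- _; set S := partial_expansion _ _ _.
set S' := partial_expansion _ _ _ => z0 b1 IH.
have : b (m + N)%N * z <= 1 * z by rewrite ler_wpM2r.
have : 1 * z <= K * (B - 1) * z by rewrite ler_wpM2r.
by move: IH; lra.
Qed.

Let is_cvg_partial : cvgn (partial_expansion B b).
Proof.
apply: nondecreasing_is_cvgn => //; exists K => _ [n _ <-].
apply: (le_trans (partial_le (leq0n n))).
rewrite /partial_expansion big_ord0 expr0 invr1 add0r.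
by rewrite ler_piMr// gerBl.
Qed.

Lemma cvg_expansion : partial_expansion B b @ \oo --> expansion B b.
Proof. exact: is_cvg_partial. Qed.

Lemma partial_expansion_le n : partial_expansion B b n <= expansion B b.
Proof. exact: nondecreasing_cvgn_le. Qed.

Lemma expansion_le n : expansion B b <= partial_expansion B b n + K * B ^- n.
Proof.
apply: limr_le => //; near=> m.
apply: (le_trans (@partial_le n m _)); first by near: m; exists n.
by rewrite lerD2l ler_wpM2l// gerBl.
Unshelve. all: by end_near. Qed.

End bounds.

(* Digits 0 and 1 in base 4 leave gaps between the intervals on which a given
   digit is read, so that a continuous function can read it. *)
Lemma expansion4_digit b n : (forall j, b j = 0 \/ b j = 1) ->
  exists2 m : nat, 0 <= 4 ^+ n.+1 * expansion 4 b - (m.*2)%:R - b n &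
    4 ^+ n.+1 * expansion 4 b - (m.*2)%:R - b n <= 3^-1.
Proof.
move=> b01; have b01' j : 0 <= b j <= 1.
  by case: (b01 j) => ->; rewrite ?lexx ?ler01.
have B2 : 2 <= 4 :> R by lra.
have KB : 1 <= 3^-1 * (4 - 1) :> R by lra.
have [m Hm] : exists m : nat, 4 ^+ n * partial_expansion 4 b n = m%:R.
  elim: n => [|n [m Hm]].
    by exists 0%N; rewrite /partial_expansion big_ord0 mulr0.
  have [c bc] : exists c : nat, b n = c%:R.
    by case: (b01 n) => ->; [exists 0%N|exists 1%N].
  exists (4 * m + c)%N; rewrite partial_expansionS mulrDr.
  rewrite exprS -mulrA Hm mulrCA divff ?mulr1 ?expf_neq0 ?pnatr_eq0//.
  by rewrite natrD natrM bc.
pose M := (2 * m)%N.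
have E : 4 ^+ n.+1 * partial_expansion 4 b n.+1 = ((2 * m).*2)%:R + b n.
  rewrite partial_expansionS mulrDr exprS -mulrA Hm -exprS.
  rewrite mulrCA divff ?mulr1 ?expf_neq0 ?pnatr_eq0//.
  by rewrite -muln2 !natrM; lra.
have X0 : 0 < 4 ^+ n.+1 :> R by rewrite exprn_gt0.
have H1 := @partial_expansion_le 4 3^-1 b B2 KB b01' n.+1.
have H2 := @expansion_le 4 3^-1 b B2 KB b01' n.+1.
move: H1; rewrite -(ler_pM2l X0) E => H1.
move: H2; rewrite -(ler_pM2l X0) mulrDr E mulrCA divff ?gt_eqF// => H2.
by exists M; rewrite /M; lra.
Qed.

Lemma continuous_expansion2 (f : nat -> R -> R) :
  (forall k, continuous (f k)) -> (forall k t, 0 <= f k t <= 1) ->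
  continuous (fun t => expansion 2 (f ^~ t)).
Proof.
move=> cf f01 t.
have B2 : 2 <= 2 :> R by [].
have KB : 1 <= 1 * (2 - 1) :> R by lra.
apply/cvgrPdist_lt => e e0.
have e3 : 0 < e / 3 by rewrite divr_gt0.
have /cvgrPdist_lt/(_ _ e3)[n _ /(_ n (leqnn n))/=] :
    (fun n => 2^-1 ^+ n : R) @ \oo --> (0 : R).
  by apply: cvg_expr; rewrite ger0_norm ?invr_ge0// invf_lt1 ?ltr1n.
rewrite sub0r normrN ger0_norm ?exprn_ge0 ?invr_ge0// exprVn => ne.
have cS : continuous (fun s => partial_expansion 2 (f ^~ s) n).
  move=> s; rewrite /partial_expansion.
  by apply: cvg_sumr => j; apply: cvgM; [exact: cf|exact: cvg_cst].
have /cvgrPdist_lt/(_ _ e3) := cS t.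
apply: filterS => s Hs.
have t1 := @partial_expansion_le 2 1 (f ^~ t) B2 KB (f01 ^~ t) n.
have t2 := @expansion_le 2 1 (f ^~ t) B2 KB (f01 ^~ t) n.
have s1 := @partial_expansion_le 2 1 (f ^~ s) B2 KB (f01 ^~ s) n.
have s2 := @expansion_le 2 1 (f ^~ s) B2 KB (f01 ^~ s) n.
move: Hs; rewrite !ltr_distl => /andP[]; lra.
Qed.

(** Orbit of [y] under the doubling map, whose threshold tests yield the binary digits. The end
    point 1 is fixed and gets the expansion with all digits 1, so that the closed unit interval is
    covered. *)
Fixpoint doubling (n : nat) y : R :=
  if n is n'.+1 then
    2 * doubling n' y - (if 2^-1 <= doubling n' y then 1 else 0)
  else y.

Definition digit (n : nat) y : R := if 2^-1 <= doubling n y then 1 else 0.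

Lemma digit01 n y : digit n y = 0 \/ digit n y = 1.
Proof. by rewrite /digit; case: ifP; [right|left]. Qed.

Lemma measurable_digit n : measurable_fun setT (digit n).
Proof.
have ms : measurable_fun setT (fun y : R => if 2^-1 <= y then 1 else 0 : R).
  apply: nondecreasing_measurable => // x y xy.
  have [x2|x2] := leP 2^-1 x; first by rewrite (le_trans x2).
  by case: ifP.
have md : measurable_fun setT (doubling n).
  elim: n => [|n IH] //=; apply: measurable_funB.
    exact: measurable_funM.
  exact: (measurableT_comp ms).
exact: (measurableT_comp ms).
Qed.

(** After [n] digits the remainder is [doubling n y * 2^-n], and the orbit stays in the unit
    interval. *)
Lemma expansion2_digit y : 0 <= y <= 1 -> expansion 2 (digit ^~ y) = y.
Proof.
move=> y01.
have d01 n : 0 <= doubling n y <= 1.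
  elim: n => [|n /andP[d0 d1]] //=.
  by have [d2|d2] := leP 2^-1 (doubling n y); apply/andP; split; lra.
have E n : partial_expansion 2 (digit ^~ y) n = y - doubling n y * 2^-1 ^+ n.
  elim: n => [|n IH]; first by rewrite /partial_expansion big_ord0 expr0 mulr1 subrr.
  rewrite partial_expansionS IH /=.
  rewrite /digit -exprVn exprS; set z := 2^-1 ^+ n; by case: ifP => _; field.
suff Ey : partial_expansion 2 (digit ^~ y) @ \oo --> y.
  exact: (cvg_lim (@Rhausdorff R) Ey).
rewrite (_ : partial_expansion _ _ =
  fun n => y - doubling n y * 2^-1 ^+ n); last exact/funext.
rewrite -[y in X in _ --> X]subr0; apply: cvgB; first exact: cvg_cst.
have h : (fun n => 2^-1 ^+ n : R) @ \oo --> (0 : R).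
  by apply: cvg_expr; rewrite ger0_norm ?invr_ge0// invf_lt1 ?ltr1n.
apply: (squeeze_cvgr _ (cvg_cst 0) h); apply: nearW => n.
have /andP[d0 d1] := d01 n.
by rewrite mulr_ge0 ?exprn_ge0 ?invr_ge0//= ler_piMl// exprn_ge0 ?invr_ge0.
Qed.

End expansion.

Section curve.
Context {R : realType}.
Implicit Types t : R.

Let kappa : R := cos (pi / 3).

Let kappa0 : 0 < kappa.
Proof.
apply: cos_gt0_pihalf; have p0 := @pi_gt0 R; apply/andP; split; lra.
Qed.

(** Schoenberg's wave: continuous, of period 2, equal to 0 on [0, 1/3] and to 1 on [1, 4/3]. A
    cosine divided by its value [kappa] at pi/3 and then clamped supplies period and plateaus; the
    period 2 is why digits are read modulo even integers. *)
Definition digit_wave t : R :=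
  clamp 0 1 ((1 - cos (pi * t) / kappa) / 2).

Lemma digit_wave01 t : 0 <= digit_wave t <= 1.
Proof.
by apply: clamp_itv.
Qed.

Lemma continuous_digit_wave : continuous digit_wave.
Proof.
move=> t; apply: (@continuous_comp R R R
  (fun t => (1 - cos (pi * t) / kappa) / 2) (clamp 0 1));
  last exact: continuous_clamp.
apply: cvgM; last exact: cvg_cst.
apply: cvgB; first exact: cvg_cst.
apply: cvgM; last exact: cvg_cst.
apply: continuous_comp; last exact: continuous_cos.
by apply: cvgM; [exact: cvg_cst|exact: cvg_id].
Qed.

Lemma digit_waveE (m : nat) (b t : R) : b = 0 \/ b = 1 ->
  0 <= t - (m.*2)%:R - b -> t - (m.*2)%:R - b <= 3^-1 -> digit_wave t = b.
Proof.
move=> b01; set s := t - _ - b => s0 s3.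
have p0 := @pi_gt0 R.
have cs : kappa <= cos (pi * s).
  have sI : pi * s \in `[0, pi].
    rewrite in_itv/=; apply/andP; split; first by rewrite mulr_ge0// ltW.
    by rewrite ler_piMr//; lra.
  have tI : (pi : R) / 3 \in `[0, pi].
    by rewrite in_itv/=; apply/andP; split; lra.
  by rewrite leNgt; apply/negP; rewrite /kappa ltr_cos// ltr_pM2l// ltNge s3.
have ct : cos (pi * t) = cos (pi * s + pi * b).
  have -> : pi * t = (pi * s + pi * b) + (pi *+ 2) *+ m.
    rewrite -mulrnA -[in RHS]mulr_natr mul2n /s; ring.
  by rewrite (periodicn (@cosD2pi R)).
rewrite /digit_wave /clamp ct; case: b01 => b0.
  rewrite b0 mulr0 addr0; apply/max_idPl.
  rewrite ge_min; apply/orP; right.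
  by rewrite pmulr_lle0 ?invr_gt0// subr_le0 ler_pdivlMr// mul1r.
rewrite b0 mulr1 cosDpi mulNr opprK.
have k1 : 1 <= cos (pi * s) / kappa by rewrite ler_pdivlMr// mul1r.
have -> : Num.min 1 ((1 + cos (pi * s) / kappa) / 2) = 1.
  by apply/min_idPl; lra.
by apply/max_idPr.
Qed.

Context {d : nat}.
Variable rho : R.
Hypothesis rho0 : 0 < rho.

Let unit_coord (i : 'I_d) (x : 'rV[R]_d) : R := (x 0 i + rho) / (2 * rho).

(** The binary digits of all coordinates are interleaved into one sequence by the coding of pairs
    [(i, k)]; positions that code no pair carry the digit 0. *)
Definition cube_digit (x : 'rV[R]_d) (j : nat) : R :=
  if unpickle j is Some (i, k) then digit k (unit_coord i x) else 0.

Definition cube_code (x : 'rV[R]_d) : R := expansion 4 (cube_digit x).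

Definition curve t : 'rV[R]_d := \row_i
  (2 * rho * expansion 2 (fun k => digit_wave (4 ^+ (pickle (i, k)).+1 * t)) - rho).

Let cube_digit01 x j : cube_digit x j = 0 \/ cube_digit x j = 1.
Proof.
by rewrite /cube_digit; case: unpickle => [[i k]|]; [exact: digit01|left].
Qed.

Let cube_digit01' x j : 0 <= cube_digit x j <= 1.
Proof. by case: (cube_digit01 x j) => ->; rewrite lexx ler01. Qed.

Let B2 : 2 <= 4 :> R. Proof. lra. Qed.
Let KB : 1 <= 3^-1 * (4 - 1) :> R. Proof. lra. Qed.

Lemma cube_code01 x : 0 <= cube_code x <= 1.
Proof.
have := @partial_expansion_le R 4 3^-1 _ B2 KB (cube_digit01' x) 0.
have := @expansion_le R 4 3^-1 _ B2 KB (cube_digit01' x) 0.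
rewrite /partial_expansion big_ord0 expr0 invr1 -/(cube_code x) => H1 H2.
by rewrite H2/=; move: H1; lra.
Qed.

Lemma measurable_cube_code : measurable_fun setT cube_code.
Proof.
apply: (@measurable_fun_cvg _ _ _ setT
    (fun n x => partial_expansion 4 (cube_digit x) n)); last first.
  by move=> x _; exact: (cvg_expansion B2 KB (cube_digit01' x)).
move=> n; apply: measurable_sum => j.
apply: measurable_funM => //; rewrite /cube_digit.
case: unpickle => [[i k]|] //.
apply: (measurableT_comp (measurable_digit k)).
apply: measurable_funM => //; apply: measurable_funD => //.
exact: measurable_coord_rV.
Qed.

(** All base 4 digits of the code are 0 or 1, so at the scale of each pair [(i, k)] it falls on a
    plateau of [digit_wave] and the digit is recovered exactly. *)
Lemma cube_codeK x : `|x| <= rho -> curve (cube_code x) = x.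
Proof.
move=> xr; apply/rowP => i; rewrite mxE.
have /andP[x1 x2] : - rho <= x 0 i <= rho.
  by rewrite -ler_norml (le_trans _ xr)// coord_le_norm.
have -> : (fun k => digit_wave (4 ^+ (pickle (i, k)).+1 * cube_code x)) =
    (fun k => digit k (unit_coord i x)).
  apply/funext => k.
  have [m H1 H2] := expansion4_digit (pickle (i, k)) (cube_digit01 x).
  rewrite (digit_waveE (cube_digit01 x _) H1 H2).
  by rewrite /cube_digit pickleK.
rewrite expansion2_digit; first by rewrite /unit_coord; field; rewrite gt_eqF.
have r2 : 0 < 2 * rho by rewrite mulr_gt0.
have xr0 : 0 <= x 0 i + rho by lra.
by rewrite /unit_coord divr_ge0 ?(ltW r2)//= ler_pdivrMr//; lra.
Qed.

Lemma continuous_curve : continuous curve.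
Proof.
move=> t; apply: cvg_rV => i; rewrite /curve mxE; under eq_cvg do rewrite mxE.
apply: cvgB; last exact: cvg_cst.
apply: cvgM; first exact: cvg_cst.
apply: (@continuous_expansion2 R
  (fun k t => digit_wave (4 ^+ (pickle (i, k)).+1 * t))) => [k s|k s];
  last exact: digit_wave01.
apply: continuous_comp; last exact: continuous_digit_wave.
by apply: cvgM; [exact: cvg_cst|exact: cvg_id].
Qed.

End curve.

(** * Compactness of probabilities on a ball *)

Lemma continuous_measurable_rV {R : realType} (d : nat) (f : 'rV[R]_d -> R) :
  continuous f -> measurable_fun setT f.
Proof.
move=> cf; apply: (measurability _ (RGenOpens.measurableE R)).
move=> _ [_ [a [b ->]] <-]; rewrite setTI; apply: open_rV_measurable.
by apply: open_comp => [x _|]; [exact: cf|exact: interval_open].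
Qed.

Section probability_integrals.
Context {R : realType}.

Lemma bounded_integrable {d} {T : measurableType d} (P : probability T R)
    (f : T -> R) (M : R) :
  measurable_fun setT f -> (forall x, `|f x| <= M) ->
  P.-integrable setT (EFin \o f).
Proof.
move=> mf fM; apply: measurable_bounded_integrable => //.
  by rewrite -ge0_fin_numE// fin_num_measure.
by exists M; split; rewrite ?num_real// => x Mx y _; exact: le_trans (ltW Mx).
Qed.

Lemma eq_Rintegral_ae {d} {T : measurableType d} (mu : {measure set T -> \bar R})
    (f g : T -> R) :
  measurable_fun setT f -> measurable_fun setT g ->
  {ae mu, forall x, f x = g x} -> \int[mu]_x f x = \int[mu]_x g x.
Proof.
move=> mf mg fg; congr fine; apply: ae_eq_integral => //.
- exact/measurable_EFinP.
- exact/measurable_EFinP.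
- by apply: filterS fg => x fgx _; rewrite fgx.
Qed.

Lemma Rintegral_eq_law {d1 d2 d} {T1 : measurableType d1}
    {T2 : measurableType d2} {S : measurableType d}
    (P1 : probability T1 R) (P2 : probability T2 R)
    (X1 : T1 -> S) (X2 : T2 -> S) (f : S -> R) (M : R) :
  measurable_fun setT X1 -> measurable_fun setT X2 ->
  (forall A, measurable A -> P1 (X1 @^-1` A) = P2 (X2 @^-1` A)) ->
  measurable_fun setT f -> (forall x, `|f x| <= M) ->
  \int[P1]_x f (X1 x) = \int[P2]_x f (X2 x).
Proof.
move=> mX1 mX2 PX mf fM; congr fine.
have mEf : measurable_fun setT (EFin \o f) by exact/measurable_EFinP.
have i1 : P1.-integrable (X1 @^-1` setT) ((EFin \o f) \o X1).
  by rewrite preimage_setT; apply: (@bounded_integrable _ T1 P1 (f \o X1) M);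
    [exact: measurableT_comp|move=> x; exact: fM].
have i2 : P2.-integrable (X2 @^-1` setT) ((EFin \o f) \o X2).
  by rewrite preimage_setT; apply: (@bounded_integrable _ T2 P2 (f \o X2) M);
    [exact: measurableT_comp|move=> x; exact: fM].
have := integral_pushforward mX1 mEf i1 measurableT.
have := integral_pushforward mX2 mEf i2 measurableT.
rewrite !preimage_setT => <- <-.
by apply: eq_measure_integral => A mA _; exact: PX.
Qed.

Lemma bounded_Rintegral_cvg {d} {T : measurableType d} (P : probability T R)
    (f_ : nat -> T -> R) (f : T -> R) (M : R) :
  (forall n, measurable_fun setT (f_ n)) -> measurable_fun setT f ->
  (forall n x, `|f_ n x| <= M) ->
  {ae P, forall x, f_ n x @[n --> \oo] --> f x} ->
  \int[P]_x f_ n x @[n --> \oo] --> \int[P]_x f x.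
Proof.
move=> mf_ mf fM cf.
have [|||||H1 _ H3] := @dominated_convergence _ T R P setT measurableT
  (fun n => EFin \o f_ n) (EFin \o f) (EFin \o cst M).
- by move=> n; exact/measurable_EFinP.
- exact/measurable_EFinP.
- by apply: filterS cf => x cx _; apply: cvg_EFin => //; exact: nearW.
- exact: finite_measure_integrable_cst.
- by apply: aeW => x n _ /=; rewrite lee_fin.
- apply: fine_cvg; rewrite fineK; first exact: H3.
  exact: integrable_fin_num.
Qed.

Lemma Rintegral_eq0_ae {d} {T : measurableType d} (P : probability T R)
    (f : T -> R) : (forall x, 0 <= f x) ->
  P.-integrable setT (EFin \o f) -> \int[P]_x f x = 0 ->
  {ae P, forall x, f x = 0}.
Proof.
move=> f0 intf Pf0; have /integrableP[mf _] := intf.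
have : (\int[P]_x `|(f x)%:E| = 0)%E.
  under eq_integral => x _ do rewrite gee0_abs ?lee_fin//.
  have := integrable_fin_num measurableT intf => /fineK <-.
  by rewrite -[fine _]/(\int[P]_x f x) Pf0.
move=> /(ae_eq_integral_abs _ measurableT mf).1.
by apply: filterS => x /(_ I) /= [].
Qed.

End probability_integrals.

Section ball_compactness.
Context {R : realType} {d : nat}.

(* Schoenberg's curve carries probabilities on the unit interval onto those on a
   cube, which reduces the compactness of the latter to Helly's selection of
   quantile functions. *)
Lemma bounded_probability_subsequence (P : nat -> probability 'rV[R]_d R)
    (rho : R) : 0 < rho ->
  (forall k, {ae P k, forall x, `|x| <= rho}) ->
  exists (s : nat -> nat) (mu : probability 'rV[R]_d R),
    (forall k, (k <= s k)%N) /\ narrow_cvg \oo (P \o s) mu.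
Proof.
move=> rho0 Prho.
have [s [Y [Z [sk mY mZ YP YZ]]]] :=
  skorokhod_subsequence P (measurable_cube_code rho) (cube_code01 rho).
have mcurve : measurable_fun setT (curve rho : R -> 'rV[R]_d).
  apply: measurable_fun_rV => i; apply: continuous_measurable_fun => t.
  exact: (@continuous_comp _ _ _ (curve rho) (fun x : 'rV[R]_d => x 0 i) t
    (@continuous_curve R d rho t) (@coord_continuous R 1 d 0 i _)).
have mW := measurableT_comp mcurve mZ.
pose W : {mfun measurableTypeR R >-> 'rV[R]_d} :=
  HB.pack_for {mfun measurableTypeR R >-> 'rV[R]_d} (curve rho \o Z)
  (isMeasurableFun.Build _ _ _ _ _ mW).
exists s, (distribution uniform01 W); split => // f cf [M fM].
have mf := continuous_measurable_rV cf.
have -> : \int[distribution uniform01 W]_x f x =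
    \int[uniform01]_u f (curve rho (Z u)).
  by apply: (@Rintegral_eq_law R _ _ _ _ _ _ (distribution uniform01 W)
    uniform01 id (curve rho \o Z) f M).
have -> : (fun k => \int[(P \o s) k]_x f x) =
    (fun k => \int[uniform01]_u f (curve rho (Y k u))).
  apply/funext => k.
  transitivity (\int[P (s k)]_x f (curve rho (cube_code rho x))).
    apply: eq_Rintegral_ae => //.
      exact (measurableT_comp mf
        (measurableT_comp mcurve (@measurable_cube_code R d rho))).
    by apply: filterS (Prho (s k)) => x xr; rewrite cube_codeK.
  apply: (@Rintegral_eq_law R _ _ _ _ _ _ (P (s k)) uniform01
     (cube_code rho) (Y k) (f \o curve rho) M) => //.
  - exact: measurable_cube_code.
  - by move=> A mA; apply: esym; exact: YP.
  - exact: measurableT_comp mf mcurve.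
  - by move=> x; exact: fM.
apply: (bounded_Rintegral_cvg (M := M)) => //.
- by move=> n; exact (measurableT_comp mf (measurableT_comp mcurve (mY n))).
- exact (measurableT_comp mf mW).
- apply: filterS YZ => u YZu.
  exact: (@cvg_comp _ _ _ (fun n => Y n u) (f \o curve rho) _ _ _ YZu
    (@continuous_comp _ _ _ (curve rho) f (Z u)
      (@continuous_curve R d rho (Z u)) (cf _))).
Qed.

End ball_compactness.

(** * Kernels and convolutions *)

Section euclidean_norm.
Context {R : realType} {d : nat}.
Implicit Types x y : 'rV[R]_d.

Lemma norm_le_coord x (c : R) : 0 <= c -> (forall i, `|x 0 i| <= c) -> `|x| <= c.
Proof.
move=> c0 xc; rewrite [leLHS]mx_normrE; apply: bigmax_le => // -[j i] _ /=.
by rewrite (ord1 j).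
Qed.

Lemma enorm_ge0 x : 0 <= enorm x. Proof. exact: sqrtr_ge0. Qed.

Lemma dotvv_ge0 x : 0 <= dotv x x.
Proof. by apply: sumr_ge0 => i _; rewrite -expr2 sqr_ge0. Qed.

Lemma coord_le_enorm x i : `|x 0 i| <= enorm x.
Proof.
rewrite -sqrtr_sqr ler_wsqrtr// /dotv (bigD1 i)//= -expr2 lerDl.
by apply: sumr_ge0 => j _; rewrite -expr2 sqr_ge0.
Qed.

Lemma norm_le_enorm x : `|x| <= enorm x.
Proof. by apply: norm_le_coord; [exact: enorm_ge0|exact: coord_le_enorm]. Qed.

Lemma enorm_le_norm x : enorm x <= d%:R * `|x|.
Proof.
rewrite -(@ler_pXn2r _ 2)// ?nnegrE ?enorm_ge0// ?mulr_ge0//.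
rewrite sqr_sqrtr ?dotvv_ge0// /dotv.
apply: (@le_trans _ _ (\sum_(i < d) `|x| ^+ 2)).
  apply: ler_sum => i _; rewrite -expr2 -real_normK ?num_real//.
  by rewrite ler_pXn2r ?nnegrE// coord_le_norm.
rewrite sumr_const card_ord -[leLHS]mulr_natl exprMn ler_wpM2r ?sqr_ge0//.
by rewrite -natrX ler_nat; case: (d) => // n; rewrite leq_pmulr.
Qed.

Lemma enorm_gt0 x : (0 < enorm x) = (x != 0).
Proof.
rewrite lt_neqAle enorm_ge0 andbT; apply/idP/idP.
  apply: contra => /eqP ->; rewrite eq_sym /enorm /dotv big1 ?sqrtr0// => i _.
  by rewrite mxE mul0r.
apply: contra => /eqP x0; rewrite -normr_le0.
by rewrite (le_trans (norm_le_enorm x))// -x0.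
Qed.

Lemma continuous_dotv (T : topologicalType) (f g : T -> 'rV[R]_d) :
  continuous f -> continuous g -> continuous (fun t => dotv (f t) (g t)).
Proof.
move=> cf cg t; apply: cvg_sumr => i.
by apply: cvgM; [exact: (@continuous_comp _ _ _ f (fun x : 'rV[R]_d => x 0 i) t
    (cf t) (@coord_continuous R 1 d 0 i _))|
  exact: (@continuous_comp _ _ _ g (fun x : 'rV[R]_d => x 0 i) t
    (cg t) (@coord_continuous R 1 d 0 i _))].
Qed.

Lemma continuous_enorm : continuous (@enorm R d).
Proof.
move=> x; apply: (@continuous_comp _ _ _ (fun x => dotv x x) Num.sqrt).
  by apply: continuous_dotv => y; exact: cvg_id.
exact: sqrt_continuous.
Qed.

End euclidean_norm.

Section kernel.
Context {R : realType} {d : nat}.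
Variable s : R.
Hypothesis s01 : 0 <= s <= 1.
Implicit Types x y z : 'rV[R]_d.

(** The coordinate factor vanishes at the origin, so the formula needs no case distinction, whatever
    value the power takes there. *)
Lemma kern_coordE z i :
  kern s z 0 i = (1 + s) * enorm z `^ (s - 1) * z 0 i.
Proof.
by rewrite /kern; case: eqP => [->|_]; rewrite !mxE ?mulr0.
Qed.

Lemma kern_le z i : `|kern s z 0 i| <= 2 * enorm z `^ s.
Proof.
have /andP[s0 s1] := s01.
have [->|z0] := eqVneq z 0.
  by rewrite kern_coordE mxE mulr0 normr0 mulr_ge0 ?powR_ge0.
rewrite kern_coordE !normrM ger0_norm; last lra.
rewrite ger0_norm ?powR_ge0// -mulrA ler_pM//; first lra.
- by rewrite mulr_ge0 ?powR_ge0.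
- lra.
rewrite (_ : enorm z `^ s = enorm z `^ (s - 1) * enorm z).
  by rewrite ler_wpM2l ?powR_ge0// coord_le_enorm.
rewrite -[X in _ * X]powRr1 ?enorm_ge0// -powRD; first by rewrite subrK.
by apply/implyP => _; rewrite gt_eqF// enorm_gt0.
Qed.

Lemma kern_continuous_neq0 z i : z != 0 ->
  {for z, continuous (fun z => kern s z 0 i)}.
Proof.
move=> z0; rewrite (_ : (fun z => _) =
    fun z => (1 + s) * enorm z `^ (s - 1) * z 0 i); last first.
  by apply/funext => y; rewrite kern_coordE.
apply: (@continuousM R 'rV[R]_d (fun z => (1 + s) * enorm z `^ (s - 1))
  (fun z => z 0 i)); last exact: coord_continuous.
apply: (@continuousM R 'rV[R]_d (cst (1 + s)) (fun z => enorm z `^ (s - 1))).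
  exact: cst_continuous.
apply: (@continuous_comp _ _ _ (@enorm R d) (fun e => e `^ (s - 1))).
  exact: continuous_enorm.
apply: differentiable_continuous; apply/derivable1_diffP.
by apply: derivable_powR; rewrite in_itv/= enorm_gt0 z0.
Qed.

(** At the origin the kernel is bounded by [2 |z|^s], which tends to 0 because [s] is positive. For
    [s = 0] it is [z / |z|] and jumps. *)
Lemma kern_continuous z i : 0 < s -> {for z, continuous (fun z => kern s z 0 i)}.
Proof.
move=> s0; have [->|] := eqVneq z 0; last exact: kern_continuous_neq0.
have k0 : kern s (0 : 'rV[R]_d) 0 i = 0 by rewrite /kern eqxx mxE.
suff : kern s z 0 i @[z --> (0 : 'rV[R]_d)] --> (0 : R).
  by rewrite -[X in _ --> X]k0.
apply/(@cvgrPdist_lt _ _ _ (nbhs (0 : 'rV[R]_d)) _ _ _).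
move=> e e0; have e20 : 0 < e / 2 by rewrite divr_gt0.
have /cvgrPdist_lt/(_ _ e20)[dl /= dl0 Hdl] := powR_cvg0 s0.
have : enorm z @[z --> (0 : 'rV[R]_d)] --> 0.
  rewrite -[X in _ --> X](_ : enorm (0 : 'rV[R]_d) = 0).
    exact: continuous_enorm.
  by apply/eqP; rewrite eq_le enorm_ge0 leNgt enorm_gt0 eqxx.
move=> /cvgrPdist_lt/(_ _ dl0); apply: filterS => y.
rewrite !sub0r !normrN ger0_norm ?enorm_ge0// => yd.
apply: (le_lt_trans (kern_le _ _)); rewrite -ltr_pdivlMl// mulrC.
have [y0|y0] := eqVneq (enorm y) 0; first by rewrite y0 powR0 ?gt_eqF.
have ey : 0 < enorm y by rewrite lt_neqAle eq_sym y0 enorm_ge0.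
have := Hdl (enorm y); rewrite /= !sub0r !normrN !ger0_norm ?powR_ge0 ?enorm_ge0//.
exact.
Qed.

Lemma measurable_kern i : measurable_fun setT (fun z : 'rV[R]_d => kern s z 0 i).
Proof.
rewrite (_ : (fun z => _) =
    fun z => (1 + s) * enorm z `^ (s - 1) * z 0 i); last first.
  by apply/funext => y; rewrite kern_coordE.
apply: measurable_funM; last exact: measurable_coord_rV.
apply: measurable_funM => //.
apply: (measurableT_comp (measurable_powR _)).
by apply: continuous_measurable_rV; exact: continuous_enorm.
Qed.

(** A domination uniform over a ball of [x]. With [e = max(1, |y|)] one has
    [|x - y| <= d (rho + 1) e] and [e^s <= 1 + |y|^s], so that mass and moment of order [s] suffice
    to integrate it. *)
Lemma kern_sub_le (rho : R) x y i : 0 <= rho -> `|x| <= rho ->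
  `|kern s (x - y) 0 i| <=
    2 * ((d%:R * (rho + 1)) `^ s * (1 + enorm y `^ s)).
Proof.
move=> rho0 xr; have /andP[s0 s1] := s01.
apply: (le_trans (kern_le _ _)); rewrite ler_wpM2l//.
set c := d%:R * (rho + 1); have c0 : 0 <= c by rewrite mulr_ge0 ?addr_ge0.
pose e := Num.max 1 (enorm y).
have e0 : 0 <= e by rewrite le_max ler01.
apply: (@le_trans _ _ ((c * e) `^ s)).
  apply: ge0_ler_powR; rewrite ?nnegrE ?enorm_ge0 ?(mulr_ge0 c0 e0)//.
  apply: (le_trans (enorm_le_norm _)); rewrite -mulrA ler_wpM2l//.
  apply: (le_trans (ler_normB _ _)).
  apply: (@le_trans _ _ (rho + enorm y)); first by rewrite lerD ?norm_le_enorm.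
  rewrite mulrDl mul1r lerD//; last by rewrite le_max lexx orbT.
  by rewrite ler_peMr// le_max lexx.
rewrite powRM// ler_wpM2l ?powR_ge0// /e /Num.max; case: ifPn => _.
  by rewrite lerDr.
by rewrite powR1 lerDl powR_ge0.
Qed.

End kernel.

Section balls.
Context {R : realType} {d : nat}.
Implicit Types x y : 'rV[R]_d.

Lemma compact_norm_ball (rho : R) : compact [set x : 'rV[R]_d | `|x| <= rho].
Proof.
apply: bounded_closed_compact.
  exists rho; split; rewrite ?num_real// => M rM x /= /le_trans; apply.
  exact: ltW.
apply: (@closed_comp _ _ (fun x : 'rV[R]_d => `|x|) [set r | r <= rho]).
  by move=> x _; exact: norm_continuous.
exact: closed_le.
Qed.

Lemma continuous_bounded_on_ball (f : 'rV[R]_d -> R) (rho : R) :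
  continuous f -> exists M : R, 0 <= M /\ forall x, `|x| <= rho -> `|f x| <= M.
Proof.
move=> cf; have := @continuous_compact _ _ f _ (continuous_subspaceT cf)
  (@compact_norm_ball rho).
move=> /compact_bounded[M [_ HM]]; exists (`|M| + 1); split.
  by rewrite addr_ge0.
move=> x xr; apply: HM; last by exists x.
by rewrite (le_lt_trans (ler_norm _))// ltrDl.
Qed.

Lemma measurable_set1_rV x : measurable [set x].
Proof.
rewrite -[X in measurable X]setCK; apply: measurableC.
apply: open_rV_measurable; apply: closed_openC.
by apply: compact_closed; [exact: norm_hausdorff|exact: compact_set1].
Qed.

(** Reduces continuity to sequences, the setting of dominated convergence. They may be taken within
    distance 1 of [x], so one dominating function for the ball of radius [|x| + 1] suffices. *)
Lemma sequential_continuous (f : 'rV[R]_d -> R) x :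
  (forall u : nat -> 'rV[R]_d, (forall n, `|x - u n| < 1) ->
    u @ \oo --> x -> f (u n) @[n --> \oo] --> f x) ->
  {for x, continuous f}.
Proof.
move=> Hu; apply/(@cvgrPdist_lt _ _ _ (nbhs x) _ _ _).
move=> e e0; apply: contrapT => H.
have /choice[u Hun] : forall n : nat, exists y,
    `|x - y| < n.+1%:R^-1 /\ e <= `|f x - f y|.
  move=> n; apply: contrapT => Hn; apply: H.
  have : nbhs x [set y | `|x - y| < n.+1%:R^-1].
    apply: ((@cvgrPdist_lt _ 'rV[R]_d _ (nbhs x) _ id x).1 cvg_id).
    by rewrite invr_gt0.
  apply: filterS => y /= xy; rewrite ltNge; apply/negP => ef; apply: Hn.
  by exists y.
have ux : u @ \oo --> x.
  apply/cvgrPdist_lt => eps eps0; near=> n.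
  apply: (lt_trans (Hun n).1); near: n.
  exact: near_infty_natSinv_lt (PosNum eps0).
have u1 n : `|x - u n| < 1.
  by apply: (lt_le_trans (Hun n).1); rewrite invf_le1 ?ler1n.
have /cvgrPdist_lt/(_ _ e0)[n _ /(_ n (leqnn n))/=] := Hu u u1 ux.
by rewrite ltNge (Hun n).2.
Unshelve. all: by end_near. Qed.

Lemma ae_neq (m : {measure set 'rV[R]_d -> \bar R}) x :
  m [set x] = 0%E -> {ae m, forall y, y <> x}.
Proof.
move=> mx0; exists [set x]; split => //; first exact: measurable_set1_rV.
by move=> y /= /contrapT.
Qed.

(** The general measure and weight serve both the Lebesgue measure weighted by [omega] and a
    probability with weight 1. When [x] moves, [k (x - y)] converges except perhaps at the single
    point [y = x], which is harmless if [k] is continuous at 0 or if [m] has no atoms. *)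
Lemma convolution_continuous (m : {measure set 'rV[R]_d -> \bar R})
    (k w : 'rV[R]_d -> R) (h : R -> 'rV[R]_d -> R) :
  measurable_fun setT k -> measurable_fun setT w ->
  (forall z, z != 0 -> {for z, continuous k}) ->
  {for 0, continuous k} \/ (forall x, m [set x] = 0%E) ->
  (forall rho, 0 <= rho -> m.-integrable setT (EFin \o h rho)) ->
  (forall rho, 0 <= rho -> {ae m, forall y, forall x, `|x| <= rho ->
     `|k (x - y) * w y| <= h rho y}) ->
  (forall x, m.-integrable setT (fun y => (k (x - y) * w y)%:E)) /\
  continuous (fun x => \int[m]_y (k (x - y) * w y)).
Proof.
move=> mk mw ck ck0 hint khw.
have mkx x : measurable_fun setT (fun y => k (x - y) * w y).
  apply: measurable_funM => //; apply: (measurableT_comp mk).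
  apply: measurable_fun_rV => i; under eq_fun do rewrite !mxE.
  by apply: measurable_funB => //; exact: measurable_coord_rV.
have kx (x : 'rV[R]_d) : m.-integrable setT (fun y => (k (x - y) * w y)%:E).
  apply/integrableP; split; first exact/measurable_EFinP.
  have /integrableP[mh +] := hint _ (normr_ge0 x); apply: le_lt_trans.
  apply: ae_ge0_le_integral => //.
  - by do 2 apply: measurableT_comp => //; exact/measurable_EFinP.
  - exact: measurableT_comp.
  - apply: filterS (khw _ (normr_ge0 x)) => y Hy _ /=.
    by rewrite lee_fin (le_trans (Hy _ _))// ler_norm.
split=> // x; apply: sequential_continuous => u u1 ux.
have rho0 : 0 <= `|x| + 1 by rewrite addr_ge0.
have uk : {ae m, forall y, k (u n - y) @[n --> \oo] --> k (x - y)}.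
  have uxy y : (u n - y) @[n --> \oo] --> x - y by apply: cvgB => //; exact: cvg_cst.
  have [c0|m0] := ck0.
    apply: aeW => y; apply: (@cvg_comp _ _ _ (fun n => u n - y) k _ _ _ (uxy y)).
    by have [->|] := eqVneq (x - y) 0; [exact: c0|exact: ck].
  apply: filterS (ae_neq (m0 x)) => y /eqP yx.
  apply: (@cvg_comp _ _ _ (fun n => u n - y) k _ _ _ (uxy y)).
  by apply: ck; rewrite subr_eq0 eq_sym.
have [|||||H1 _ H3] := @dominated_convergence _ _ R m setT measurableT
  (fun n y => (k (u n - y) * w y)%:E) (fun y => (k (x - y) * w y)%:E)
  (EFin \o h (`|x| + 1)).
- by move=> n; exact/measurable_EFinP.
- exact/measurable_EFinP.
- apply: filterS uk => y uky _; apply: cvg_EFin; first exact: nearW.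
  by apply: cvgM => //; exact: cvg_cst.
- exact: hint.
- apply: filterS (khw _ rho0) => y Hy n _ /=; rewrite lee_fin; apply: Hy.
  have un : `|u n - x| <= 1 by rewrite distrC ltW.
  by rewrite -[u n](subrK x) (le_trans (ler_normD _ _))// addrC lerD2l.
- apply: fine_cvg; rewrite fineK; first exact: H3.
  exact: integrable_fin_num.
Qed.

End balls.

Section ae_bounded.
Context {R : realType} {d} {T : measurableType d}.
Variable P : probability T R.

Lemma ae_bounded_integrable (f : T -> R) (M : R) : measurable_fun setT f ->
  {ae P, forall x, `|f x| <= M} -> P.-integrable setT (EFin \o f).
Proof.
move=> mf fM; apply/integrableP; split; first exact/measurable_EFinP.
apply: (@le_lt_trans _ _ (\int[P]_x (cst `|M|%:E x))%E).
  apply: ae_ge0_le_integral => //.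
  - by do 2 apply: measurableT_comp => //; exact/measurable_EFinP.
  - by move=> x _ /=; rewrite lee_fin.
  - by apply: filterS fM => x Hx _ /=; rewrite lee_fin (le_trans Hx)// ler_norm.
by rewrite integral_cst//= probability_setT mule1 ltry.
Qed.

Lemma le_norm_Rintegral_bound (f : T -> R) (M : R) : 0 <= M ->
  measurable_fun setT f -> {ae P, forall x, `|f x| <= M} ->
  `|\int[P]_x f x| <= M.
Proof.
move=> M0 mf fM.
apply: (le_trans (le_normr_Rintegral _ (ae_bounded_integrable mf fM))) => //.
have MM : - M <= M by lra.
(* Clamping turns the almost everywhere bound into one valid at every point, so that the integrals
   can be compared pointwise. *)
rewrite (@eq_Rintegral_ae _ _ _ _ _ (fun x => clamp (- M) M `|f x|)).
- have mc : measurable_fun setT (fun x => clamp (- M) M `|f x|).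
    apply: measurable_maxr => //; apply: measurable_minr => //.
    exact: measurableT_comp.
  apply: (@le_trans _ _ (\int[P]_x cst M x)).
    apply: le_Rintegral => //.
    + apply: (@bounded_integrable _ _ _ _ _ M) => // x.
      by rewrite ler_norml; exact: clamp_itv.
    + exact: finite_measure_integrable_cst.
    + by move=> x _; case/andP: (clamp_itv `|f x| MM).
  by rewrite Rintegral_cst//= probability_setT mulr1.
- exact: measurableT_comp.
- apply: measurable_maxr => //; apply: measurable_minr => //.
  exact: measurableT_comp.
- apply: filterS fM => x Hx; rewrite clamp_id// Hx andbT.
  by rewrite (le_trans _ (normr_ge0 _))// oppr_le0.
Qed.

End ae_bounded.

Section kernel_convolution.
Context {R : realType} {d : nat}.
Variable s : R.
Hypothesis s01 : 0 <= s <= 1.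
Implicit Types x y : 'rV[R]_d.

(** A point is a box with degenerate sides. Dimension zero is excluded: there the measure is a unit
    mass at the only point. *)
Lemma lebesgue_rV_set1 x : (1 <= d)%N -> lebesgue_rV d [set x] = 0%E.
Proof.
move=> d1.
have -> : [set x] = [set y | forall i, [set x 0 i] (y 0 i)].
  by apply/seteqP; split=> [y ->//|y Hy]; apply/rowP => i; exact: Hy.
rewrite (@lebesgue_rV_box R d (fun i => [set x 0 i])) => [|i]; last first.
  exact: measurable_set1.
rewrite (bigD1 (Ordinal d1))//= lebesgue_measure_set1 mul0e//.
Qed.

(** The moment of order [s] makes the dominating function from [kern_sub_le] integrable, and the
    absence of Lebesgue atoms absorbs the jump of the kernel when [s = 0]. *)
Lemma kern_conv_continuous (w : 'rV[R]_d -> R) : (1 <= d)%N ->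
  (forall x, 0 <= w x) -> (lebesgue_rV d).-integrable setT (EFin \o w) ->
  (\int[lebesgue_rV d]_x (enorm x `^ s * w x)%:E < +oo)%E ->
  forall i, continuous (fun x => kern_conv s w x 0 i).
Proof.
move=> d1 w0 iw isw i.
pose h (rho : R) y : R :=
  2 * (d%:R * (rho + 1)) `^ s * (w y + enorm y `^ s * w y).
have mw : measurable_fun setT w by apply/measurable_EFinP; case/integrableP: iw.
have msw : measurable_fun setT (fun y => enorm y `^ s * w y).
  apply: measurable_funM => //.
  apply: (measurableT_comp (measurable_powR _)).
  by apply: continuous_measurable_rV; exact: continuous_enorm.
rewrite (_ : (fun x => _) =
    fun x => \int[lebesgue_rV d]_y (kern s (x - y) 0 i * w y)); last first.
  by apply/funext => x; rewrite mxE.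
have [||||||_ +] := @convolution_continuous R d (lebesgue_rV d)
    (fun z => kern s z 0 i) w h; last by [].
- exact: measurable_kern.
- exact: mw.
- by move=> z; exact: kern_continuous_neq0.
- by right => x; exact: lebesgue_rV_set1.
- move=> rho rho0.
  rewrite (_ : EFin \o h rho = fun y => ((2 * (d%:R * (rho + 1)) `^ s)%:E *
      ((w y)%:E + (enorm y `^ s * w y)%:E))%E)//.
  apply: integrableZl => //; apply: integrableD => //.
  apply/integrableP; split; first exact/measurable_EFinP.
  under eq_integral => y _ do
    rewrite gee0_abs ?lee_fin ?mulr_ge0 ?powR_ge0//.
  exact: isw.
- move=> rho rho0; apply: aeW => y x xr; rewrite /h normrM (ger0_norm (w0 y)).
  have -> : w y + enorm y `^ s * w y = (1 + enorm y `^ s) * w y.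
    by rewrite mulrDl mul1r.
  rewrite mulrA ler_wpM2r// -mulrA.
  exact: kern_sub_le.
Qed.

Definition kern_bound (rho0 rho : R) : R :=
  2 * ((d%:R * (rho + 1)) `^ s * (1 + (d%:R * rho0) `^ s)).

Lemma kern_bound_ge0 rho0 rho : 0 <= kern_bound rho0 rho.
Proof. by rewrite mulr_ge0// mulr_ge0 ?addr_ge0 ?powR_ge0. Qed.

Lemma kern_sub_le_bound (rho0 rho : R) x y i : 0 <= rho -> `|x| <= rho ->
  `|y| <= rho0 -> `|kern s (x - y) 0 i| <= kern_bound rho0 rho.
Proof.
move=> r0 xr yr; apply: (le_trans (kern_sub_le s01 y i r0 xr)).
rewrite /kern_bound ler_wpM2l// ler_wpM2l ?powR_ge0// lerD2l.
have /andP[s0 _] := s01.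
have dr : 0 <= d%:R * rho0 by rewrite mulr_ge0// (le_trans (normr_ge0 y)).
apply: ge0_ler_powR; rewrite ?nnegrE ?enorm_ge0//.
by apply: (le_trans (enorm_le_norm _)); rewrite ler_wpM2l.
Qed.

Lemma measurable_kern_sub x i :
  measurable_fun setT (fun y : 'rV[R]_d => kern s (x - y) 0 i).
Proof.
apply: (@measurableT_comp _ _ _ _ _ _ (fun z => kern s z 0 i) setT
  (fun y => x - y)); first exact: measurable_kern.
apply: measurable_fun_rV => j; under eq_fun do rewrite !mxE.
by apply: measurable_funB => //; exact: measurable_coord_rV.
Qed.

Section mconv.
Variables (nu : probability 'rV[R]_d R) (rho0 : R).
Hypothesis nu_rho0 : {ae nu, forall y, `|y| <= rho0}.

Lemma kern_mconv_bound rho x i : 0 <= rho -> `|x| <= rho ->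
  `|kern_mconv s nu x 0 i| <= kern_bound rho0 rho.
Proof.
move=> r0 xr; rewrite mxE; apply: le_norm_Rintegral_bound.
- exact: kern_bound_ge0.
- exact: measurable_kern_sub.
- by apply: filterS nu_rho0 => y yr; exact: kern_sub_le_bound.
Qed.

Lemma kern_sub_integrable x i :
  nu.-integrable setT (fun y => (kern s (x - y) 0 i)%:E).
Proof.
apply: (@ae_bounded_integrable _ _ _ nu _ (kern_bound rho0 `|x|)).
  exact: measurable_kern_sub.
by apply: filterS nu_rho0 => y yr; exact: kern_sub_le_bound.
Qed.

Lemma kern_mconv_continuous i : 0 < s \/ (forall x, nu [set x] = 0%E) ->
  continuous (fun x => kern_mconv s nu x 0 i).
Proof.
move=> H.
rewrite (_ : (fun x => _) =
    fun x => \int[nu]_y (kern s (x - y) 0 i * cst 1 y)); last first.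
  by apply/funext => x; rewrite mxE; apply: eq_Rintegral => y _; rewrite mulr1.
have [||||||_ +] := @convolution_continuous R d nu (fun z => kern s z 0 i) (cst 1)
  (fun rho => cst (kern_bound rho0 rho)); last by [].
- exact: measurable_kern.
- exact: measurable_cst.
- by move=> z; exact: kern_continuous_neq0.
- by case: H => [s0|]; [left; exact: kern_continuous|right].
- by move=> rho _; exact: finite_measure_integrable_cst.
- move=> rho r0; apply: filterS nu_rho0 => y yr x xr; rewrite mulr1.
  exact: kern_sub_le_bound.
Qed.

End mconv.
End kernel_convolution.

(** * Flow and dissipation *)

(** Second countability: a point off the support has a null neighbourhood, hence lies in a null ball
    with rational centre and radius [1/(n + 1)]; the union of these countably many balls is null. *)
Lemma msupport_ae {R : realType} {d : nat}
    (mu : {measure set 'rV[R]_d -> \bar R}) (C : set 'rV[R]_d) :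
  msupport mu `<=` C -> {ae mu, forall x, C x}.
Proof.
move=> muC.
pose B (p : 'rV[rat]_d * nat) : set 'rV[R]_d :=
  ball (\row_i (ratr (p.1 0 i) : R)) p.2.+1%:R^-1.
pose F n := if unpickle n is Some p then
  (if mu (B p) == 0%E then B p else set0) else set0.
suff HF : ~` C `<=` \bigcup_n F n.
  apply: negligibleS HF _; apply: negligible_bigcup => n; rewrite /F.
  case: unpickle => [p|]; last exact: negligible_set0.
  case: eqP => [B0|_]; last exact: negligible_set0.
  exists (B p); split => //; apply: open_rV_measurable; exact: ball_open.
move=> x Cx.
have [U [[oU Ux] U0]] : exists U, open_nbhs x U /\ mu U = 0%E.
  apply: contrapT => H; apply: Cx; apply: muC => U xU.
  rewrite lt_neqAle measure_ge0 andbT; apply/eqP => U0; apply: H.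
  by exists U; split.
have /nbhs_ballP[e /= e0 eU] : nbhs x U by exact: open_nbhs_nbhs.
have [n ne] : exists n, n.+1%:R^-1 < e / 2.
  have [n _ /(_ n (leqnn n))] :=
    near_infty_natSinv_lt (PosNum (divr_gt0 e0 (ltr0n R 2))).
  by exists n.
have n0 : 0 < n.+1%:R^-1 :> R by rewrite invr_gt0.
have /choice[q Hq] i : exists q : rat, `|ratr q - x 0 i| < n.+1%:R^-1.
  have /rat_in_itvoo[q] : x 0 i < x 0 i + n.+1%:R^-1 by rewrite ltrDl.
  rewrite in_itv/= => /andP[q1 q2]; exists q.
  by rewrite gtr0_norm ?subr_gt0// ltrBlDl.
pose p := (\row_i q i, n) : 'rV[rat]_d * nat.
have Bx : B p x.
  split=> // i j; rewrite (ord1 i).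
  suff -> : (\row_i (ratr (p.1 0 i) : R)) 0 j = ratr (q j) by exact: Hq.
  by rewrite !mxE.
have BU : B p `<=` U.
  move=> y By; apply: eU; rewrite [e]splitr.
  apply: (ball_triangle (y := \row_i (ratr (p.1 0 i) : R))).
    by apply: le_ball (ball_sym Bx); exact: ltW.
  by apply: le_ball By; exact: ltW.
exists (pickle p) => //; rewrite /F pickleK.
rewrite (_ : mu (B p) == 0%E)//; apply/eqP.
apply: (subset_measure0 _ _ BU U0); apply: open_rV_measurable => //.
exact: ball_open.
Qed.

(** Mean value theorem coordinate by coordinate, which loses nothing in the sup norm. Derivatives
    are given at positive times only; continuity on the closed half line brings in [t = 0]. *)
Lemma path_lipschitz {R : realType} {d : nat} (g v : R -> 'rV[R]_d)
    (V : R) : 0 <= V ->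
  {within `[0, +oo[, continuous g} ->
  (forall t : R, 0 < t -> is_derive t 1 g (v t)) ->
  (forall (t : R) i, 0 < t -> `|v t 0 i| <= V) ->
  forall t h : R, 0 <= t -> 0 <= h -> `|g (t + h) - g t| <= V * h.
Proof.
move=> V0 cg dg vV t h t0; rewrite le_eqVlt => /orP[/eqP <-|h0].
  by rewrite addr0 subrr normr0 mulr0.
apply: norm_le_coord; first by rewrite mulr_ge0// ltW.
move=> i; rewrite !mxE.
have th : t < t + h by rewrite ltrDl.
have [||c + Ec] := @MVT R (fun u => g u 0 i) (fun u => v u 0 i) _ _ th.
- move=> x; rewrite in_itv/= => /andP[tx _].
  have x0 : 0 < x by exact: le_lt_trans tx.
  have dgx := dg _ x0; split.
    exact: (derivable_mxP _ _ _).1 (@ex_derive _ _ _ _ _ _ _ dgx) 0 i.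
  by rewrite -(@derive_val _ _ _ _ _ _ _ dgx) derive_mx ?mxE.
- have cg' : {within `[t, t + h], continuous g}.
    apply: continuous_subspaceW cg => x.
    rewrite /= !in_itv/= andbT => /andP[tx _].
    exact: le_trans tx.
  move=> x; exact: (@continuous_comp _ _ _ (g : subspace _ -> _)
    (fun x : 'rV[R]_d => x 0 i) x
    (cg' x) (@coord_continuous R 1 d 0 i _)).
rewrite in_itv/= => /andP[tc _]; rewrite Ec (addrC t h) addrK normrM.
rewrite (gtr0_norm h0) (ler_wpM2r (ltW h0))// vV//.
exact: le_lt_trans tc.
Qed.

(** [E] decreases to its infimum, so beyond some [T] it drops by less than [e h] over any interval
    of length [h]; the mean value theorem finds there a time with [D < e], without integrating [D]
    over time. *)
Lemma small_dissipation_times {R : realType} (E D : R -> R) (m : R) :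
  (forall t : R, 0 < t -> is_derive t 1 E (- D t)) ->
  (forall t, 0 <= D t) -> (forall t : R, 0 <= t -> m <= E t) ->
  forall h e : R, 0 < h -> 0 < e -> exists2 T : R, 0 < T &
    forall t : R, T <= t -> exists s, [/\ t < s, s < t + h & D s < e].
Proof.
move=> dE D0 Em h e h0 e0.
have mvt (a b : R) : 0 < a -> a < b ->
    exists2 c, c \in `]a, b[ & E a - E b = D c * (b - a).
  move=> a0 ab; have [||c cab Ec] := @MVT R E (fun t => - D t) a b ab.
  - by move=> x; rewrite in_itv/= => /andP[ax _]; apply: dE; exact: lt_trans ax.
  - apply: derivable_within_continuous => x; rewrite in_itv/= => /andP[ax _].
    by apply: ex_derive; apply: dE; exact: lt_le_trans ax.
  - by exists c => //; rewrite -opprB Ec mulNr opprK.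
have End (a b : R) : 0 < a -> a <= b -> E b <= E a.
  move=> a0; rewrite le_eqVlt => /orP[/eqP -> //|ab].
  have [c _ Ec] := mvt _ _ a0 ab.
  by rewrite -subr_ge0 Ec mulr_ge0// subr_ge0 ltW.
pose S := [set E t | t in [set t : R | 0 < t]].
have iS : has_inf S.
  split; first by exists (E 1); exists 1 => /=.
  by exists m => _ [t /= t0 <-]; apply: Em; exact: ltW.
have [_ [T /= T0 <-] ET] := inf_adherent (mulr_gt0 e0 h0) iS.
exists T => // t Tt.
have t0 : 0 < t by exact: lt_le_trans Tt.
have th : t < t + h by rewrite ltrDl.
have [s + Es] := mvt _ _ t0 th; rewrite in_itv/= => /andP[ts sth].
exists s; split => //; rewrite -(ltr_pM2r h0).
have -> : D s * h = E t - E (t + h) by rewrite Es addrC addKr.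
have H1 : inf S <= E (t + h).
  by apply: ge_inf; [case: iS|exists (t + h) => //=; rewrite addr_gt0].
have H2 := End _ _ T0 Tt.
by rewrite ltrBlDr addrC (le_lt_trans H2)// (lt_le_trans ET)// lerD2r.
Qed.

(** * Narrow limits of measures carried by a ball *)

Section narrow_limits.
Context {R : realType} {d : nat}.
Implicit Types (f : 'rV[R]_d -> R) (P : nat -> probability 'rV[R]_d R).
Implicit Types (mu : probability 'rV[R]_d R).

(** Compactness of the ball gives one [dl] for all [x]. The point [y] is left free, which suits
    arguments whose perturbation may leave the ball. *)
Lemma uniform_continuous_on_ball f (rho e : R) : continuous f -> 0 < e ->
  exists2 dl : R, 0 < dl &
    forall x y, `|x| <= rho -> `|x - y| < dl -> `|f x - f y| < e.
Proof.
move=> cf e0.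
have e20 : 0 < e / 2 by rewrite divr_gt0.
have /(_ R 0^'+ (fun dl x => forall y, `|x - y| < dl -> `|f x - f y| < e)) :=
  (compact_near_coveringP _).1 (@compact_norm_ball R d rho).
case.
- move=> x _.
  have Hx : nbhs x [set y | `|f x - f y| < e / 2].
    exact: ((@cvgrPdist_lt _ _ _ (nbhs x) _ f (f x)).1 (cf x) _ e20).
  move/nbhs_ballP : Hx => [dl /= dl0 Hdl].
  have dl20 : 0 < dl / 2 by rewrite divr_gt0.
  exists ([set x' | `|x - x'| < dl / 2], [set t | t < dl / 2]).
    split=> /=.
      exact: ((@cvgrPdist_lt _ 'rV[R]_d _ (nbhs x) _ id x).1 cvg_id).
    exact: nbhs_right_lt.
  move=> [x' t] /= [xx' tdl] y x'y.
  have H1 : `|f x - f x'| < e / 2.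
    apply: Hdl; rewrite mx_norm_ball /ball_/=.
    by apply: (lt_trans xx'); rewrite ltr_pdivrMr// ltr_pMr// ltr1n.
  have H2 : `|f x - f y| < e / 2.
    apply: Hdl; rewrite mx_norm_ball /ball_/=.
    rewrite -[x](subrK x') -addrA (le_lt_trans (ler_normD _ _))//.
    by rewrite [dl]splitr ltrD// (lt_trans x'y).
  rewrite distrC in H1.
  by rewrite -(subrKA (f x)) (le_lt_trans (ler_normD _ _))// [e]splitr ltrD.
- move=> dl /= dl0 Hdl; exists (dl / 2); first by rewrite divr_gt0.
  move=> x y xr xy; apply: (Hdl (dl / 2) _ _ x xr y xy).
    rewrite /= sub0r normrN gtr0_norm ?divr_gt0//.
    by rewrite ltr_pdivrMr// ltr_pMr// ltr1n.
  by rewrite divr_gt0.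
Qed.

Lemma cvg_subseq_ge (u : nat -> nat) : (forall n, (n <= u n)%N) -> u @ \oo --> \oo.
Proof.
move=> nu A [N _ NA]; exists N => // n /= Nn; apply: NA => /=.
exact: leq_trans (nu n).
Qed.

Lemma narrow_cvg_subseq P mu (u : nat -> nat) : (forall n, (n <= u n)%N) ->
  narrow_cvg \oo P mu -> narrow_cvg \oo (P \o u) mu.
Proof.
move=> nu Pmu f cf bf.
exact: (cvg_comp _ _ (cvg_subseq_ge nu) (Pmu f cf bf)).
Qed.

(** Tested on the truncated excess of the norm over [rho], a bounded continuous function whose zero
    set is exactly the ball. *)
Lemma narrow_limit_ae P mu (rho : R) : narrow_cvg \oo P mu ->
  (forall n, {ae P n, forall x, `|x| <= rho}) -> {ae mu, forall x, `|x| <= rho}.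
Proof.
move=> Pmu Prho.
pose f (x : 'rV[R]_d) := clamp 0 1 (`|x| - rho).
have cf : continuous f.
  move=> x; apply: (@continuous_comp _ _ _ (fun x : 'rV[R]_d => `|x| - rho)
    (clamp 0 1));
    last exact: continuous_clamp.
  apply: (@continuousB R R 'rV[R]_d (fun x => `|x|) (cst rho)).
    exact: norm_continuous.
  exact: cst_continuous.
have mf := continuous_measurable_rV cf.
have f01 x : 0 <= f x <= 1 by exact: clamp_itv.
have fM x : `|f x| <= 1 by have /andP[f0 f1] := f01 x; rewrite ger0_norm.
have f0 x : (f x == 0) = (`|x| <= rho).
  rewrite /f /clamp; apply/idP/idP => [/eqP H|H].
    rewrite leNgt; apply/negP; rewrite -subr_gt0 => xr.
    have : 0 < Num.max 0 (Num.min 1 (`|x| - rho)).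
      by rewrite lt_max lt_min ltr01 xr orbT.
    by rewrite H ltxx.
  by apply/eqP/max_idPl; rewrite ge_min subr_le0 H orbT.
have P0 n : \int[P n]_x f x = 0.
  rewrite (@eq_Rintegral_ae _ _ _ _ _ (cst 0)) ?Rintegral_cst ?mul0r//.
  by apply: filterS (Prho n) => x; rewrite -f0 => /eqP.
have := Pmu f cf (ex_intro _ 1 fM); under eq_cvg do rewrite P0.
move=> /(cvg_unique (@Rhausdorff R) (cvg_cst 0)) mu0.
have imf := @bounded_integrable _ _ _ mu f 1 mf fM.
have f_ge0 x : 0 <= f x by case/andP: (f01 x).
apply: filterS (Rintegral_eq0_ae f_ge0 imf (esym mu0)) => x.
by rewrite -f0 => ->.
Qed.

(** Clamping [f] at its bound on the ball yields a bounded test function and alters no integral,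
    neither along the sequence nor in the limit. *)
Lemma narrow_cvg_continuous P mu (rho : R) f : narrow_cvg \oo P mu ->
  (forall n, {ae P n, forall x, `|x| <= rho}) -> continuous f ->
  \int[P n]_x f x @[n --> \oo] --> \int[mu]_x f x.
Proof.
move=> Pmu Prho cf.
have murho := narrow_limit_ae Pmu Prho.
have [M [M0 fM]] := continuous_bounded_on_ball rho cf.
have MM : - M <= M by lra.
pose g x := clamp (- M) M (f x).
have cg : continuous g.
  by move=> x; apply: (@continuous_comp _ _ _ f (clamp (- M) M));
    [exact: cf|exact: continuous_clamp].
have gf (nu : probability 'rV[R]_d R) : {ae nu, forall x : 'rV[R]_d, `|x| <= rho} ->
    \int[nu]_x f x = \int[nu]_x g x.
  move=> nur; apply: eq_Rintegral_ae; try exact: continuous_measurable_rV.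
  by apply: filterS nur => x xr; rewrite /g clamp_id// -ler_norml fM.
rewrite (gf _ murho); under eq_cvg do rewrite (gf _ (Prho _)).
apply: Pmu => //; exists M => x; rewrite ler_norml; exact: clamp_itv.
Qed.

End narrow_limits.

Section flow.
Context {R : realType} {d : nat}.
Variables (P0 : probability 'rV[R]_d R) (phi : R -> probability 'rV[R]_d R).
Variables (X : R -> 'rV[R]_d -> 'rV[R]_d) (rho : R).
Hypothesis mX : forall t, 0 <= t -> measurable_fun setT (X t).
Hypothesis phiX : forall t, 0 <= t -> forall A, measurable A ->
  phi t A = P0 (X t @^-1` A).
Hypothesis phi_rho : forall t, 0 <= t -> {ae phi t, forall x, `|x| <= rho}.

(** The quantifiers over times and over almost every point have to be exchanged: rational times cost
    only a countable union of null sets, and right continuity of the paths extends the bound to all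
    times. *)
Lemma flow_in_ball :
  {ae P0, forall x, {within `[0, +oo[, continuous (X ^~ x)}} ->
  {ae P0, forall x t, 0 <= t -> `|X t x| <= rho}.
Proof.
move=> cX.
have oB : open [set x : 'rV[R]_d | rho < `|x|].
  apply: (@open_comp _ _ (fun x : 'rV[R]_d => `|x|) [set r | rho < r]).
    by move=> x _; exact: norm_continuous.
  exact: open_gt.
have mB := open_rV_measurable oB.
pose q n : R := `|ratr (odflt 0 (unpickle n))|.
have Hq : {ae P0, forall x n, `|X (q n) x| <= rho}.
  apply: ae_foralln => n; have qn0 : 0 <= q n by exact: normr_ge0.
  exists (X (q n) @^-1` [set x | rho < `|x|]); split.
  - by rewrite -[X in measurable X]setTI; apply: mX.
  - transitivity (phi (q n) [set x | rho < `|x|]); first exact/esym/phiX.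
    have [N [mN N0 HN]] := phi_rho qn0.
    apply: (subset_measure0 mB mN _ N0) => x /= xr; apply: HN => /=.
    by rewrite leNgt xr.
  - by move=> x /= /negP; rewrite -ltNge.
apply: filterS2 cX Hq => x cx Hx t t0; rewrite leNgt; apply/negP => Xt.
pose f u := `|X u x|.
have cf : {within `[0, +oo[, continuous f}.
  move=> u; exact: (@continuous_comp _ _ _ (X ^~ x : subspace _ -> _)
    (fun y : 'rV[R]_d => `|y|) u (cx u) (@norm_continuous _ _ _)).
have ft : f u @[u --> t^'+] --> f t.
  move/continuous_within_itvcyP : cf => [cf f0].
  move: t0; rewrite le_eqVlt => /orP[/eqP <- //|t0].
  by apply: cvg_at_right_filter; apply: cf; rewrite in_itv/= t0.
have := cvgr_gt _ ft _ Xt => -[dl /= dl0 Hdl].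
have /rat_in_itvoo[p] : t < t + dl by rewrite ltrDl.
rewrite in_itv/= => /andP[tp pdl].
have : rho < f (ratr p).
  by apply: Hdl => //=; rewrite distrC gtr0_norm ?subr_gt0// ltrBlDl.
have := Hx (pickle p); rewrite /q pickleK/= ger0_norm; last first.
  by rewrite (le_trans t0)// ltW.
by rewrite leNgt => /negP.
Qed.

(** Both integrals are pulled back along the flow to [P0], where positions at [t_ n] and [s_ n]
    differ by at most [V / (n + 1)]; uniform continuity of [f] on the ball makes the integrals
    close. *)
Lemma narrow_cvg_perturb (V : R) (t_ s_ : nat -> R)
    (mu : probability 'rV[R]_d R) :
  {ae P0, forall x t, 0 <= t -> `|X t x| <= rho} ->
  {ae P0, forall x t h, 0 <= t -> 0 <= h -> `|X (t + h) x - X t x| <= V * h} ->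
  0 <= V ->
  (forall n, 0 <= t_ n) -> (forall n, t_ n < s_ n < t_ n + n.+1%:R^-1) ->
  narrow_cvg \oo (phi \o t_) mu -> narrow_cvg \oo (phi \o s_) mu.
Proof.
move=> Xrho XV V0 t0 ts tmu f cf bf; have [M fM] := bf.
have s0 n : 0 <= s_ n by have /andP[H _] := ts n; rewrite (le_trans (t0 n))// ltW.
have mf := continuous_measurable_rV cf.
have law t : 0 <= t -> \int[phi t]_x f x = \int[P0]_x f (X t x).
  move=> tt; apply: (@Rintegral_eq_law R _ _ _ _ _ _ (phi t) P0 id (X t) f M) => //.
  - exact: mX.
  - by move=> A mA; rewrite preimage_id phiX.
rewrite -[X in _ --> X]add0r.
rewrite (_ : (fun n => _) = fun n =>
    (\int[P0]_x f (X (s_ n) x) - \int[P0]_x f (X (t_ n) x)) +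
    \int[(phi \o t_) n]_x f x); last first.
  by apply/funext => n /=; rewrite !law// subrK.
apply: cvgD; last exact: tmu.
apply/cvgrPdist_le => e e0.
have [dl dl0 Hdl] := uniform_continuous_on_ball rho cf e0.
near=> n; rewrite sub0r normrN.
have iX t : 0 <= t -> P0.-integrable setT (EFin \o (f \o X t)).
  move=> tt; apply: (@bounded_integrable _ _ _ _ _ M) => [|x]; last exact: fM.
  by apply: measurableT_comp => //; exact: mX.
rewrite -(RintegralB measurableT (iX _ (s0 n)) (iX _ (t0 n))).
apply: le_norm_Rintegral_bound; first exact: ltW.
  by apply: measurable_funB; apply: measurableT_comp => //; exact: mX.
apply: filterS2 Xrho XV => x xr xV; apply/ltW/Hdl; first exact: xr.
have /andP[ts1 ts2] := ts n.
have h0 : 0 <= s_ n - t_ n by rewrite subr_ge0 ltW.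
have E : t_ n + (s_ n - t_ n) = s_ n by rewrite addrC subrK.
have := xV _ _ (t0 n) h0; rewrite E => /le_lt_trans; apply.
apply: (@le_lt_trans _ _ (V * n.+1%:R^-1)).
  by rewrite ler_wpM2l// lerBlDl ltW.
have H : n.+1%:R^-1 < dl / (V + 1).
  near: n; apply: (near_infty_natSinv_lt (PosNum _)) => //.
  by rewrite divr_gt0// ltr_wpDl.
have V1 : 0 < V + 1 by rewrite ltr_wpDl.
move: H; rewrite ltr_pdivlMr// mulrC => /(le_lt_trans _); apply.
by rewrite ler_wpM2r// lerDl.
Unshelve. all: by end_near. Qed.

End flow.

(** * Passage to the limit in the flux *)

Section uniform_kernel_convergence.
Context {R : realType} {d : nat}.
Implicit Types (x y z : 'rV[R]_d) (nu mu : probability 'rV[R]_d R).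

Lemma continuous_sub_arg (g : 'rV[R]_d -> R) x :
  continuous g -> continuous (fun y => g (x - y)).
Proof.
move=> cg y; apply: (@continuous_comp _ _ _ (fun y => x - y) g); last exact: cg.
apply: (@continuousB R 'rV[R]_d 'rV[R]_d (cst x) id); first exact: cst_continuous.
exact: cvg_id.
Qed.

(** At a single [x0] this is narrow convergence. It spreads to a neighbourhood of [x0] because the
    translates of [g] are equicontinuous over [y] in the ball, whatever the measure; compactness
    then makes the rank uniform in [x]. *)
Lemma mconv_cvg_uniform (P : nat -> probability 'rV[R]_d R) mu (rho : R)
    (g : 'rV[R]_d -> R) (e : R) :
  narrow_cvg \oo P mu -> (forall n, {ae P n, forall x, `|x| <= rho}) ->
  continuous g -> 0 < e ->
  \forall n \near \oo, forall x, `|x| <= rho ->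
    `|\int[P n]_y g (x - y) - \int[mu]_y g (x - y)| <= e.
Proof.
move=> Pmu Prho cg e0.
have murho := narrow_limit_ae Pmu Prho.
have e30 : 0 < e / 3 by rewrite divr_gt0.
have := (compact_near_coveringP _).1 (@compact_norm_ball R d rho) nat \oo
  (fun n x => `|\int[P n]_y g (x - y) - \int[mu]_y g (x - y)| <= e).
move=> /(_ _)/(_ _); apply => x0 x0r.
have [dl dl0 Hdl] := uniform_continuous_on_ball (`|x0| + rho) cg e30.
have close nu : {ae nu, forall x, `|x| <= rho} -> forall x, `|x0 - x| < dl ->
    `|\int[nu]_y g (x - y) - \int[nu]_y g (x0 - y)| <= e / 3.
  move=> nur x xd.
  have [M [_ HM]] := continuous_bounded_on_ball (`|x| + `|x0| + rho) cg.
  have ig z : `|z| <= `|x| + `|x0| ->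
      nu.-integrable setT (EFin \o (fun y => g (z - y))).
    move=> zr; apply: (@ae_bounded_integrable _ _ _ nu _ M).
      exact: (continuous_measurable_rV (continuous_sub_arg cg)).
    apply: filterS nur => y yr; apply: HM.
    by rewrite (le_trans (ler_normB _ _))// lerD.
  rewrite -RintegralB//; [|by apply: ig; rewrite lerDl|by apply: ig; rewrite lerDr].
  apply: le_norm_Rintegral_bound; first exact: ltW.
    by apply: measurable_funB; exact: (continuous_measurable_rV (continuous_sub_arg cg)).
  apply: filterS nur => y yr; rewrite distrC; apply/ltW/Hdl.
    by rewrite (le_trans (ler_normB _ _))// lerD2l.
  by rewrite opprB addrA subrK.
have : \forall n \near \oo,
    `|\int[mu]_y g (x0 - y) - \int[P n]_y g (x0 - y)| < e / 3.
  apply: ((@cvgrPdist_lt _ _ _ \oo _ _ _).1 _ _ e30).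
  exact: (narrow_cvg_continuous Pmu Prho (continuous_sub_arg cg)).
move=> Hn.
exists ([set x | `|x0 - x| < dl],
  [set n | `|\int[mu]_y g (x0 - y) - \int[P n]_y g (x0 - y)| < e / 3]).
  split=> //=.
  exact: ((@cvgrPdist_lt _ 'rV[R]_d _ (nbhs x0) _ id x0).1 cvg_id).
move=> [x n] /= [xd H1].
have := close _ (Prho n) x xd; have := close _ murho x xd.
move: H1; rewrite !ler_norml !ltr_norml => /andP[? ?] /andP[? ?] /andP[? ?].
by apply/andP; split; lra.
Qed.

Definition hat (e : R) z : R := clamp 0 1 (1 - enorm z / e).

Lemma hat01 e z : 0 <= hat e z <= 1. Proof. exact: clamp_itv. Qed.

Lemma continuous_hat e : continuous (hat e).
Proof.
move=> z; apply: (@continuous_comp _ _ _ (fun z => 1 - enorm z / e) (clamp 0 1));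
  last exact: continuous_clamp.
apply: (@continuousB R R 'rV[R]_d (cst 1) (fun z => enorm z / e)).
  exact: cst_continuous.
apply: (@continuousM R 'rV[R]_d (@enorm R d) (cst e^-1));
  last exact: cst_continuous.
exact: continuous_enorm.
Qed.

Definition kern0_reg (e : R) (i : 'I_d) z : R := z 0 i / Num.max e (enorm z).

Lemma continuous_kern0_reg e i : 0 < e -> continuous (kern0_reg e i).
Proof.
move=> e0 z.
apply: (@continuousM R 'rV[R]_d (fun z => z 0 i)
  (fun z => (Num.max e (enorm z))^-1)).
  exact: coord_continuous.
apply: (@continuousV R 'rV[R]_d (fun z => Num.max e (enorm z))).
  by rewrite gt_eqF// lt_max e0.
apply: (@continuous_max R 'rV[R]_d (cst e) (@enorm R d)).
  exact: cst_continuous.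
exact: continuous_enorm.
Qed.

(** Inside radius [e] the error is at most [|z| (1/|z| - 1/e) = 1 - |z|/e], which dictates the shape
    of [hat]; outside, the two kernels agree. *)
Lemma kern0_reg_le e i z : 0 < e -> `|kern 0 z 0 i - kern0_reg e i z| <= hat e z.
Proof.
move=> e0.
have [->|z0] := eqVneq z 0.
  rewrite kern_coordE /kern0_reg mxE mulr0 mul0r subrr normr0.
  by case/andP: (hat01 e (0 : 'rV[R]_d)).
have n0 : 0 < enorm z by rewrite enorm_gt0.
rewrite kern_coordE addr0 mul1r sub0r powRN powRr1 ?enorm_ge0// /kern0_reg.
rewrite mulrC -mulrBr normrM.
have [ez|ze] := leP e (enorm z).
  by rewrite subrr normr0 mulr0; case/andP: (hat01 e z).
have D0 : 0 <= (enorm z)^-1 - e^-1 by rewrite subr_ge0 lef_pV2 ?posrE ?(ltW ze).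
rewrite (ger0_norm D0).
rewrite /hat clamp_id; last first.
  rewrite gerBl divr_ge0 ?(ltW n0) ?(ltW e0)//= andbT subr_ge0.
  by rewrite ler_pdivrMr// mul1r (ltW ze).
apply: (@le_trans _ _ (enorm z * ((enorm z)^-1 - e^-1))).
  by rewrite (ler_wpM2r D0) ?coord_le_enorm.
by rewrite mulrBr divff ?gt_eqF.
Qed.

(* The bound on the mass of small balls given by a density below M; tested on
   continuous functions, it passes to narrow limits. *)
Definition spread nu (M : R) : Prop := forall x (e : R), 0 < e ->
  \int[nu]_y hat e (x - y) <= M * (2 * e) ^+ d.

Lemma measurable_hat_sub e x : measurable_fun setT (fun y => hat e (x - y)).
Proof. exact: (continuous_measurable_rV (continuous_sub_arg (@continuous_hat e))). Qed.

Lemma hat_norm_le1 e z : `|hat e z| <= 1.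
Proof. by have /andP[h0 h1] := hat01 e z; rewrite ger0_norm. Qed.

Lemma hat_integrable nu e x :
  nu.-integrable setT (EFin \o (fun y => hat e (x - y))).
Proof.
apply: (@bounded_integrable _ _ _ _ _ 1); first exact: measurable_hat_sub.
by move=> y; exact: hat_norm_le1.
Qed.

Lemma indic_integrable nu (A : set 'rV[R]_d) : measurable A ->
  nu.-integrable setT (EFin \o (\1_A : 'rV[R]_d -> R)).
Proof.
move=> mA; apply: (@bounded_integrable _ _ _ _ _ 1) => // y.
by rewrite indicE; case: (y \in A); rewrite ?normr1 ?normr0.
Qed.

Lemma Rintegral_indic nu (A : set 'rV[R]_d) : measurable A ->
  \int[nu]_y \1_A y = fine (nu A).
Proof. by move=> mA; rewrite /Rintegral integral_indic// setIT. Qed.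

(** The tent [hat] is dominated by the indicator of the cube of side [2 e], whose volume is the
    product of its sides; this is the origin of [(2 e)^d]. *)
Lemma bounded_density_spread nu (f : 'rV[R]_d -> R) (M : R) : 0 <= M ->
  is_density nu f -> {ae lebesgue_rV d, forall x, f x <= M} -> spread nu M.
Proof.
move=> M0 [mf f0 nuf] fM x e e0.
pose A i := `[x 0 i - e, x 0 i + e]%classic.
pose B := [set y : 'rV[R]_d | forall i, A i (y 0 i)].
have mB : measurable B.
  have -> : B = \bigcap_(i in [set: 'I_d]) ((fun y : 'rV[R]_d => y 0 i) @^-1` A i).
    by apply/seteqP; split=> t /= At; [move=> i _|move=> i]; exact: At.
  apply: fin_bigcap_measurable => // i _.
  rewrite -[X in measurable X]setTI; apply: measurable_coord_rV => //.
  exact: measurable_itv.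
have leB : lebesgue_rV d B = ((2 * e) ^+ d)%:E.
  rewrite lebesgue_rV_box => [|i]; last exact: measurable_itv.
  transitivity (\prod_(i < d) (2 * e)%:E)%E.
    apply: eq_bigr => i _; rewrite lebesgue_measure_itv/= lte_fin ltrD2l.
    rewrite (_ : - e < e); last lra.
    by rewrite -EFinB; congr EFin; ring.
  by rewrite prodEFin prodr_const card_ord.
have nuB : (nu B <= (M * (2 * e) ^+ d)%:E)%E.
  rewrite nuf// EFinM -leB -integral_cst//.
  apply: ae_ge0_le_integral => //.
  - by move=> y _; rewrite lee_fin.
  - by apply/measurable_EFinP; exact: measurable_funTS.
  - by apply: filterS fM => y fy _; rewrite /= lee_fin.
apply: (@le_trans _ _ (\int[nu]_y \1_B y)).
  apply: le_Rintegral => //; [exact: hat_integrable|exact: indic_integrable|].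
  move=> y _; rewrite indicE; have [_|yB] := boolP (y \in B).
    by case/andP: (hat01 e (x - y)).
  suff -> : hat e (x - y) = 0 by [].
  rewrite /hat /clamp; apply/max_idPl; rewrite ge_min subr_le0; apply/orP; right.
  rewrite ler_pdivlMr// mul1r leNgt; apply/negP => xye.
  move/negP: yB; apply; rewrite inE /B /A /= => i; rewrite in_itv/=.
  have := coord_le_enorm (x - y) i; rewrite !mxE => /le_lt_trans => /(_ _ xye).
  by rewrite ltr_norml => /andP[? ?]; apply/andP; split; lra.
rewrite Rintegral_indic// -lee_fin fineK ?fin_num_measure//.
Qed.

Lemma spread_limit (P : nat -> probability 'rV[R]_d R) mu (M : R) :
  narrow_cvg \oo P mu -> (forall n, spread (P n) M) -> spread mu M.
Proof.
move=> Pmu PM x e e0.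
have H := Pmu _ (@continuous_sub_arg _ x (@continuous_hat e))
  (ex_intro (fun M : R => forall y, `|hat e (x - y)| <= M) 1
    (fun y => hat_norm_le1 e (x - y))).
by apply: (cvgr_to_le H); apply: nearW => n; exact: PM.
Qed.

Hypothesis d1 : (1 <= d)%N.

Lemma spread_small (M eta : R) : 0 <= M -> 0 < eta ->
  exists2 e : R, 0 < e & M * (2 * e) ^+ d <= eta.
Proof.
move=> M0 eta0.
have M1 : 0 < M + 1 by rewrite ltr_wpDl.
(* [t] plays the role of [2 e]: being at most 1 it dominates its power [t^d], as [d >= 1]; and
   [M + 1] avoids a division by zero. *)
pose t : R := Num.min 1 (eta / (M + 1)).
have t0 : 0 < t by rewrite lt_min ltr01 divr_gt0.
have t1 : t <= 1 by rewrite ge_min lexx.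
exists (t / 2); first by rewrite divr_gt0.
have -> : 2 * (t / 2) = t by field.
apply: (@le_trans _ _ (M * t)).
  by rewrite ler_wpM2l// ler_iXnr ?(ltW t0).
apply: (@le_trans _ _ ((M + 1) * t)); first by rewrite ler_wpM2r ?(ltW t0)// lerDl.
by rewrite mulrC -ler_pdivlMr// ge_min lexx orbT.
Qed.

Lemma spread_set1 nu (M : R) x : 0 <= M -> spread nu M -> nu [set x] = 0%E.
Proof.
move=> M0 nuM.
have m1 := measurable_set1_rV x.
rewrite -[LHS]fineK ?fin_num_measure//; congr EFin.
apply/eqP; rewrite eq_le fine_ge0// andbT leNgt; apply/negP => c0.
have c20 : 0 < fine (nu [set x]) / 2 by rewrite divr_gt0.
have [e e0 He] := spread_small M0 c20.
have : fine (nu [set x]) <= fine (nu [set x]) / 2.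
  apply: le_trans He; apply: le_trans (nuM x e e0).
  rewrite -Rintegral_indic//; apply: le_Rintegral => //.
  - exact: indic_integrable.
  - exact: hat_integrable.
  - move=> y _; rewrite indicE; have [|_] := boolP (y \in [set x]); last first.
      by case/andP: (hat01 e (x - y)).
    rewrite inE => ->; rewrite subrr /hat.
    have -> : enorm (0 : 'rV[R]_d) = 0.
      by apply/eqP; rewrite eq_le enorm_ge0 leNgt enorm_gt0 eqxx.
    by rewrite mul0r subr0 clamp_id// lexx ler01.
by rewrite leNgt => /negP; apply; rewrite ltr_pdivrMr// ltr_pMr// ltr1n.
Qed.

(** For [s > 0] the kernel is itself continuous. For [s = 0] it is replaced by [kern0_reg] at a
    scale [dl] for which [spread] makes the error at most [e / 3], for all [P n] and for [mu] at
    once. *)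
Lemma kern_mconv_cvg_uniform (s : R) (P : nat -> probability 'rV[R]_d R) mu
    (rho e : R) (i : 'I_d) : 0 <= s <= 1 ->
  narrow_cvg \oo P mu -> (forall n, {ae P n, forall x, `|x| <= rho}) ->
  0 < s \/ (s = 0 /\ exists2 M, 0 <= M & forall n, spread (P n) M) ->
  0 < e ->
  \forall n \near \oo, forall x, `|x| <= rho ->
    `|kern_mconv s (P n) x 0 i - kern_mconv s mu x 0 i| <= e.
Proof.
move=> s01 Pmu Prho H e0.
have murho := narrow_limit_ae Pmu Prho.
case: H => [s0|[s0 [M M0 PM]]].
  have ck : continuous (fun z : 'rV[R]_d => kern s z 0 i).
    by move=> z; exact: kern_continuous.
  have := mconv_cvg_uniform Pmu Prho ck e0.
  by apply: filterS => n Hn x xr; rewrite !mxE; exact: Hn.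
have muM := spread_limit Pmu PM.
have e30 : 0 < e / 3 by rewrite divr_gt0.
have [dl dl0 Hdl] := spread_small M0 e30.
have cg := @continuous_kern0_reg dl i dl0.
have close nu : {ae nu, forall x, `|x| <= rho} -> spread nu M -> forall x,
    `|kern_mconv s nu x 0 i - \int[nu]_y kern0_reg dl i (x - y)| <= e / 3.
  move=> nur nuM x; rewrite mxE.
  have [M' [_ HM]] := continuous_bounded_on_ball (`|x| + rho) cg.
  have ig : nu.-integrable setT (EFin \o (fun y => kern0_reg dl i (x - y))).
    apply: (@ae_bounded_integrable _ _ _ nu _ M').
      exact: (continuous_measurable_rV (continuous_sub_arg cg)).
    apply: filterS nur => y yr; apply: HM.
    by rewrite (le_trans (ler_normB _ _))// lerD2l.
  have ik := kern_sub_integrable s01 nur x i.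
  rewrite -RintegralB//.
  have iB : nu.-integrable setT
      (EFin \o (fun y => kern s (x - y) 0 i - kern0_reg dl i (x - y))).
    rewrite (_ : _ \o _ = (fun y => (kern s (x - y) 0 i)%:E -
      (kern0_reg dl i (x - y))%:E)%E)//.
    exact: integrableB.
  apply: (le_trans (le_normr_Rintegral measurableT iB)).
  apply: (le_trans _ (le_trans (nuM x dl dl0) Hdl)).
  apply: le_Rintegral => //.
  - exact: (integrable_norm iB).
  - exact: hat_integrable.
  - by move=> y _; rewrite s0 kern0_reg_le.
have := mconv_cvg_uniform Pmu Prho cg e30; apply: filterS => n Hn x xr.
have := Hn x xr; have := close _ (Prho n) (PM n) x; have := close _ murho muM x.
rewrite !ler_norml => /andP[? ?] /andP[? ?] /andP[? ?].
by apply/andP; split; lra.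
Qed.

End uniform_kernel_convergence.

Lemma energy_lower_bound {R : realType} {d : nat} (a r : R)
    (omega : 'rV[R]_d -> R) (phi : R -> probability 'rV[R]_d R) :
  (forall t : R, 0 <= t -> energy a r omega (phi t) \is a fin_num) ->
  (-oo < ereal_inf
    [set energy a r omega mu | mu in energy_defined a r omega])%E ->
  exists m : R, forall t : R, 0 <= t -> m <= fine (energy a r omega (phi t)).
Proof.
move=> Efin; set I := ereal_inf _ => I0.
have IE t : 0 <= t -> (I <= energy a r omega (phi t))%E.
  (* Were both parts infinite, the energy would be [+oo - +oo], which evaluates to [-oo]; finiteness
     thus makes [phi t] a competitor in the infimum. *)
  move=> t0; apply: ereal_inf_lbound; exists (phi t) => // -[Ha Hr].
  have := Efin t t0; rewrite /energy Ha Hr gt0_muley ?lte_fin//.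
have Ifin : I \is a fin_num.
  by rewrite fin_numElt I0 (le_lt_trans (IE 0 (lexx 0)))// ltey_eq Efin.
exists (fine I) => t t0; apply: fine_le => //; [exact: Efin|exact: IE].
Qed.

Lemma Lnorm_oo_ae {R : realType} {d} {T : measurableType d}
    (mu : {measure set T -> \bar R}) (f : T -> R) (M : R) :
  ('N[mu]_+oo [EFin \o f] <= M%:E)%E -> {ae mu, forall x, `|f x| <= M}.
Proof.
rewrite unlock /Lnorm.
(* The norm is the essential supremum only when the measure has positive mass; otherwise every
   property holds almost everywhere. *)
case: ifPn => [_ /ess_supP|].
  by apply: filterS => x /=; rewrite lee_fin.
rewrite -leNgt measure_le0 => /eqP mu0 _.
by exists setT; split.
Qed.

Section limit_of_flow.
Context {R : realType} {d : nat}.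
Variables (a r rho : R) (omega : 'rV[R]_d -> R).
Hypotheses (d1 : (1 <= d)%N) (r01 : 0 <= r <= 1).
Hypothesis conv_cont : forall i, continuous (fun x => kern_conv a omega x 0 i).

Lemma flux_continuous (nu : probability 'rV[R]_d R) :
  {ae nu, forall y, `|y| <= rho} -> 0 < r \/ (forall x, nu [set x] = 0%E) ->
  forall i, continuous (fun x => flux a r omega nu x 0 i).
Proof.
move=> nur H i.
rewrite (_ : (fun x => _) =
  (fun x => kern_conv a omega x 0 i - kern_mconv r nu x 0 i)); last first.
  by apply/funext => x; rewrite !mxE.
move=> x; apply: (@continuousB R R 'rV[R]_d (fun x => kern_conv a omega x 0 i)
  (fun x => kern_mconv r nu x 0 i)); first exact: conv_cont.
exact: (kern_mconv_continuous r01 nur H).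
Qed.

(** Exchanging the flux of [P n] for that of [mu] in the integrand has a uniformly small cost. What
    remains is the fixed continuous function [q mu], whose integral passes to the limit and
    vanishes, so the flux vanishes [mu]-almost everywhere. *)
Lemma flux_dissipation_limit (P : nat -> probability 'rV[R]_d R)
    (mu : probability 'rV[R]_d R) :
  narrow_cvg \oo P mu -> (forall n, {ae P n, forall x, `|x| <= rho}) ->
  0 < r \/ (r = 0 /\ exists2 M, 0 <= M & forall n, spread (P n) M) ->
  \int[P n]_x (enorm (flux a r omega (P n) x) ^+ 2) @[n --> \oo] --> (0 : R) ->
  zero_flux_stationary a r omega mu.
Proof.
move=> Pmu Prho H D0.
have murho := narrow_limit_ae Pmu Prho.
have muH : 0 < r \/ (forall x, mu [set x] = 0%E).
  case: H => [|[r0 [M M0 PM]]]; [by left|right => x].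
  exact: (spread_set1 d1 x M0 (spread_limit Pmu PM)).
have PH n : 0 < r \/ (forall x, P n [set x] = 0%E).
  case: H => [|[r0 [M M0 PM]]]; [by left|right => x].
  exact: (spread_set1 d1 x M0 (PM n)).
split; first by move=> x i; exact: (kern_sub_integrable r01 murho).
pose q (nu : probability 'rV[R]_d R) x :=
  dotv (flux a r omega nu x) (flux a r omega nu x).
have qE nu x : enorm (flux a r omega nu x) ^+ 2 = q nu x.
  by rewrite sqr_sqrtr// dotvv_ge0.
have cF (nu : probability 'rV[R]_d R) : {ae nu, forall x, `|x| <= rho} ->
    0 < r \/ (forall x, nu [set x] = 0%E) -> continuous (flux a r omega nu).
  move=> nur nuH x; apply: (@cvg_rV R 'rV[R]_d (nbhs x) _ d _ _) => i.
  exact: (flux_continuous nur nuH).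
have cq (nu : probability 'rV[R]_d R) : {ae nu, forall x, `|x| <= rho} ->
    0 < r \/ (forall x, nu [set x] = 0%E) -> continuous (q nu).
  by move=> nur nuH; apply: continuous_dotv; exact: cF.
have iq (nu nu' : probability 'rV[R]_d R) : {ae nu, forall x, `|x| <= rho} ->
    continuous (q nu') -> nu.-integrable setT (EFin \o q nu').
  move=> nur cq'; have [M [_ HM]] := continuous_bounded_on_ball rho cq'.
  apply: (@ae_bounded_integrable _ _ _ nu _ M).
    exact: continuous_measurable_rV.
  by apply: filterS nur => x; exact: HM.
have cqm := cq _ murho muH.
have [C [C0 HC]] : exists C : R, 0 <= C /\
    forall x i, `|x| <= rho -> `|flux a r omega mu x 0 i| <= C.
  have /choice[c Hc] i :=
    continuous_bounded_on_ball rho (@flux_continuous mu murho muH i).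
  exists (\sum_i c i); split; first by apply: sumr_ge0 => i _; case: (Hc i).
  move=> x i xr; apply: (le_trans ((Hc i).2 x xr)).
  by rewrite (bigD1 i)//= lerDl; apply: sumr_ge0 => j _; case: (Hc j).
have qP0 : \int[P n]_x q mu x @[n --> \oo] --> (0 : R).
  rewrite -[X in _ --> X]add0r.
  rewrite (_ : (fun n => _) = fun n =>
    (\int[P n]_x q mu x - \int[P n]_x q (P n) x) +
    \int[P n]_x (enorm (flux a r omega (P n) x) ^+ 2)); last first.
    apply/funext => n; rewrite -[LHS](subrK (\int[P n]_x q (P n) x)).
    by congr (_ + _); apply: eq_Rintegral => x _; rewrite qE.
  apply: cvgD => //.
  apply/cvgrPdist_le => e e0.
  (* With [F] the limit flux and [w] the deviation, each coordinate contributes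
     [F^2 - (F - w)^2 = (2 F - w) w], at most [(2 C + 1) eta] as soon as [eta <= 1]; the factor [d]
     counts the coordinates. *)
  pose c := d%:R * (2 * C + 1).
  have c0 : 0 <= c by rewrite mulr_ge0// addr_ge0// mulr_ge0.
  have c1 : 0 < c + 1 by rewrite ltr_wpDl.
  pose eta := Num.min 1 (e / (c + 1)).
  have eta0 : 0 < eta by rewrite lt_min ltr01 divr_gt0.
  have eta1 : eta <= 1 by rewrite ge_min lexx.
  have ceta : c * eta <= e.
    apply: (@le_trans _ _ ((c + 1) * eta)).
      by rewrite ler_wpM2r ?(ltW eta0)// lerDl.
    by rewrite mulrC -ler_pdivlMr// ge_min lexx orbT.
  have : \forall n \near \oo, forall i x, `|x| <= rho ->
      `|kern_mconv r (P n) x 0 i - kern_mconv r mu x 0 i| <= eta.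
    by apply: filter_forall => i; exact: kern_mconv_cvg_uniform.
  apply: filterS => n Hn; rewrite sub0r normrN.
  have cqn := cq _ (Prho n) (PH n).
  rewrite -RintegralB//; [|exact: iq|exact: iq].
  apply: le_norm_Rintegral_bound; first exact: ltW.
    by apply: measurable_funB; exact: continuous_measurable_rV.
  apply: filterS (Prho n) => x xr.
  rewrite /q /dotv -sumrB; apply: (le_trans (ler_norm_sum _ _ _)).
  apply: le_trans ceta; rewrite /c -mulrA.
  rewrite [leRHS]mulr_natl -[X in _ *+ X]card_ord -sumr_const.
  apply: ler_sum => i _.
  have F1 := HC x i xr; have F2 := Hn i x xr.
  set F := flux a r omega mu x 0 i in F1 *.
  have FE : flux a r omega (P n) x 0 i =
      F - (kern_mconv r (P n) x 0 i - kern_mconv r mu x 0 i).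
    by rewrite /F !mxE; ring.
  rewrite FE; set w := kern_mconv _ _ _ _ _ - _ in F2 *.
  rewrite (_ : F * F - (F - w) * (F - w) = (2 * F - w) * w); last by ring.
  rewrite normrM ler_pM//; apply: (le_trans (ler_normB _ _)).
  by rewrite lerD ?(le_trans F2)// normrM ger0_norm// ler_wpM2l.
have q0 : \int[mu]_x q mu x = 0.
  apply: (cvg_unique (@Rhausdorff R) _ qP0).
  exact: (narrow_cvg_continuous Pmu Prho cqm).
have ae0 : {ae mu, forall x, flux a r omega mu x = 0}.
  apply: filterS (Rintegral_eq0_ae _ (iq _ _ murho cqm) q0) => [x qx0|x].
    apply/eqP; rewrite -[_ == _]negbK -enorm_gt0 -leNgt.
    by rewrite -[leRHS]sqrtr0 -qx0.
  exact: dotvv_ge0.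
move=> xi [Cxi _]; have [cxi _] := Cxi 0%N.
have cdot : continuous (fun x => dotv (xi x) (flux a r omega mu x)).
  by apply: continuous_dotv => //; exact: cF.
rewrite (@ae_eq_integral _ _ _ mu setT (cst 0%E)) ?integral0//.
- by apply/measurable_EFinP; exact: continuous_measurable_rV.
- apply: filterS ae0 => x Fx _; rewrite Fx /dotv big1// => i _.
  by rewrite mxE mulr0.
Qed.

End limit_of_flow.

(** * Convergence as time tends to infinity *)

(** By contradiction, one test function at a time: failure of convergence supplies times [t_ n > n]
    at which its integral stays at distance at least [e] from the limit, and no subsequence can then
    converge. *)
Lemma is_narrow_cvg_pinfty {R : realType} {d : nat}
    (phi : R -> probability 'rV[R]_d R) (mu : probability 'rV[R]_d R) :
  (forall t_ : nat -> R, (forall n, n%:R < t_ n) ->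
    exists s : nat -> nat, (forall n, (n <= s n)%N) /\
      narrow_cvg \oo (phi \o t_ \o s) mu) ->
  narrow_cvg +oo phi mu.
Proof.
move=> H f cf bf; apply/cvgrPdist_lt => e e0; apply: contrapT => Hn.
have /choice[t_ Ht] : forall n : nat, exists t : R,
    n%:R < t /\ e <= `|\int[mu]_x f x - \int[phi t]_x f x|.
  move=> n; apply: contrapT => nt; apply: Hn; exists n%:R; split => //.
  by move=> t /= nlt; rewrite ltNge; apply/negP => et; apply: nt; exists t.
have [s [sn Hs]] := H t_ (fun n => (Ht n).1).
have /cvgrPdist_lt/(_ _ e0)[n _ /(_ n (leqnn n))/=] := Hs f cf bf.
by rewrite ltNge (Ht (s n)).2.
Qed.

Lemma cvg_natr_lt {R : realType} (t_ : nat -> R) (s : nat -> nat) :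
  (forall n, n%:R < t_ n) -> (forall n, (n <= s n)%N) ->
  t_ (s n) @[n --> \oo] --> +oo.
Proof.
move=> nt ns; apply/cvgryPge => A; near=> n.
apply: (le_trans _ (ltW (nt (s n)))); apply: (@le_trans _ _ n%:R).
  by near: n; exact: nbhs_infty_ger.
by rewrite ler_nat.
Unshelve. all: by end_near. Qed.

Theorem corollary8p9 (R : realType) (d : nat) (a r : R)
    (omega : 'rV[R]_d -> R) (phi : R -> probability 'rV[R]_d R)
    (rho : R -> 'rV[R]_d -> R) (X : R -> 'rV[R]_d -> 'rV[R]_d)
    (d_ge1 : (1 <= d)%N)
    (a01 : 0 <= a <= 1)
    (r01 : 0 <= r <= 1)
    (omega_ge0 : forall x, 0 <= omega x)
    (omega_L1 : omega \in Lfun (lebesgue_rV d) 1%E)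
    (omega_Loo : omega \in Lfun (lebesgue_rV d) +oo%E)
    (solution : lagrangian_solution a r omega phi rho X)
    (dissipation : energy_dissipation a r omega phi)
    (energy_bounded_below :
      (-oo < ereal_inf [set energy a r omega mu | mu in energy_defined a r omega])%E)
    (moment_q : exists q : R, [/\ Num.max a r < q,
      (ereal_sup [set \int[phi t]_x (enorm x `^ q)%:E | t in [set t : R | (0 <= t)%R]]
        < +oo)%E &
      (\int[lebesgue_rV d]_x (enorm x `^ q * omega x)%:E < +oo)%E])
    (bounded_support : exists Rstar : R, forall t, 0 <= t ->
      msupport (phi t) `<=` [set x | enorm x < Rstar])
    (moment_a : (\int[lebesgue_rV d]_x (enorm x `^ a * omega x)%:E < +oo)%E)
    (bounded_density : r = 0 ->
      (ereal_sup [set 'N[lebesgue_rV d]_+oo [EFin \o rho t] | t in [set t : R | (0 <= t)%R]]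
        < +oo)%E) :
  (forall mu, omega_limit phi mu -> zero_flux_stationary a r omega mu) /\
  (forall phibar, omega_limit phi phibar ->
    zero_flux_stationary a r omega phibar ->
    (forall mu, omega_limit phi mu -> zero_flux_stationary a r omega mu ->
      forall A, measurable A -> mu A = phibar A) ->
    narrow_cvg +oo phi phibar).
Proof.
have phi_rho : exists2 rad : R, 0 < rad &
    forall t : R, 0 <= t -> {ae phi t, forall x, `|x| <= rad}.
  (* The radius is made positive, as the curve onto the cube requires, and the Euclidean ball is
     enlarged to one of the sup norm. *)
  have [Rs HR] := bounded_support; exists (`|Rs| + 1); first by rewrite ltr_wpDl.
  move=> t t0; apply: filterS (msupport_ae (HR t t0)) => x /= xR.
  rewrite (le_trans (norm_le_enorm x))// (le_trans (ltW xR))//.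
  by rewrite (le_trans (ler_norm _))// lerDl.
have [rad rad0 phirho] := phi_rho.
have conv_cont i : continuous (fun x => kern_conv a omega x 0 i).
  by apply: (kern_conv_continuous a01) => //; exact/Lfun1_integrable.
have [M M0 phiM] : exists2 M : R, 0 <= M &
    r = 0 -> forall t : R, 0 <= t -> spread (phi t) M.
  have [r0|r0] := eqVneq r 0; last by exists 0 => // r0'; rewrite r0' eqxx in r0.
  have := bounded_density r0; set S := ereal_sup _ => Soo.
  have HS t : 0 <= t -> ('N[lebesgue_rV d]_+oo [EFin \o rho t] <= S)%E.
    by move=> t0; apply: ereal_sup_ubound; exists t.
  have S0 : (0 <= S)%E by apply: (le_trans _ (HS 0 (lexx 0))); exact: Lnorm_ge0.
  have Sfin : S \is a fin_num by rewrite ge0_fin_numE.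
  exists (fine S); first exact: fine_ge0.
  move=> _ t t0; apply: (bounded_density_spread _ (lagrangian_density solution t0)).
    exact: fine_ge0.
  have := HS t t0; rewrite -[X in (_ <= X)%E](fineK Sfin) => /Lnorm_oo_ae.
  by apply: filterS => x; apply: le_trans; exact: ler_norm.
have rH (t_ : nat -> R) : (forall n, 0 <= t_ n) ->
    0 < r \/ (r = 0 /\ exists2 M, 0 <= M & forall n, spread (phi (t_ n)) M).
  move=> t0; have /andP[r0 _] := r01; move: r0; rewrite le_eqVlt.
  move=> /orP[/eqP r0|]; last by left.
  by right; split => //; exists M => // n; exact: (phiM (esym r0)).
have [C [C0 HC]] : exists C : R, 0 <= C /\
    forall x i, `|x| <= rad -> `|kern_conv a omega x 0 i| <= C.
  have /choice[c Hc] i := continuous_bounded_on_ball rad (@conv_cont i).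
  exists (\sum_i c i); split; first by apply: sumr_ge0 => i _; case: (Hc i).
  move=> x i xr; apply: (le_trans ((Hc i).2 x xr)).
  by rewrite (bigD1 i)//= lerDl; apply: sumr_ge0 => j _; case: (Hc j).
(* Speed bound per coordinate: [C] for the attraction, the kernel bound for two points of the ball
   for the repulsion. *)
pose V : R := C + @kern_bound R d r rad rad.
have V0 : 0 <= V by rewrite addr_ge0// kern_bound_ge0.
have ode := lagrangian_ode solution.
have Xrho : {ae phi 0, forall x t, 0 <= t -> `|X t x| <= rad}.
  apply: (flow_in_ball (lagrangian_flow_measurable solution)
    (lagrangian_pushforward solution) phirho).
  by apply: filterS ode => x [].
have XV : {ae phi 0, forall x t h, 0 <= t -> 0 <= h ->
    `|X (t + h) x - X t x| <= V * h}.
  apply: filterS2 Xrho ode => x xr [_ cX dX] t h t0 h0.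
  apply: (path_lipschitz V0 cX dX) => // u i u0.
  have Xu := xr u (ltW u0).
  have k1 := HC (X u x) i Xu.
  have k2 := kern_mconv_bound r01 (phirho u (ltW u0)) i (ltW rad0) Xu.
  move: k1 k2; rewrite /V !mxE => k1 k2.
  by apply: (le_trans (ler_normD _ _)); rewrite normrN lerD.
have [Efin dE] := dissipation.
have [m Em] := energy_lower_bound Efin energy_bounded_below.
have D0 t : 0 <= \int[phi t]_x (enorm (flux a r omega (phi t) x) ^+ 2).
  by apply: Rintegral_ge0 => x _; exact: sqr_ge0.
have stationary mu : omega_limit phi mu -> zero_flux_stationary a r omega mu.
  move=> [t_ [too tmu]].
  have /choice[us Hus] : forall n : nat, exists us : nat * R,
      [/\ (n <= us.1)%N, 0 <= t_ us.1, t_ us.1 < us.2 < t_ us.1 + n.+1%:R^-1 &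
        \int[phi us.2]_x (enorm (flux a r omega (phi us.2) x) ^+ 2) < n.+1%:R^-1].
    move=> n; have n0 : 0 < n.+1%:R^-1 :> R by rewrite invr_gt0.
    have [T T0 HT] := small_dissipation_times dE D0 Em n0 n0.
    have [N _ HN] := (cvgryPge _).1 too T.
    (* The index [maxn n N] is late enough for small dissipation and at least [n], which keeps the
       chosen indices cofinal. *)
    have Tt : T <= t_ (maxn n N) by apply: HN => /=; exact: leq_maxr.
    have [s [s1 s2 Ds]] := HT _ Tt.
    exists (maxn n N, s); split => //=; first exact: leq_maxl.
      by rewrite (le_trans (ltW T0)).
    by rewrite s1 s2.
  pose P n := phi (us n).2.
  have s0 n : 0 <= (us n).2.
    by have [_ t0 /andP[ts _] _] := Hus n; rewrite (le_trans t0)// ltW.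
  have Pmu : narrow_cvg \oo P mu.
    apply: (narrow_cvg_perturb (t_ := fun n => t_ (us n).1) (s_ := fun n => (us n).2)
      (lagrangian_flow_measurable solution) (lagrangian_pushforward solution)
      Xrho XV V0).
    - by move=> n; have [] := Hus n.
    - by move=> n; have [] := Hus n.
    - apply: (narrow_cvg_subseq (P := phi \o t_) (u := fun n => (us n).1)) => // n.
      by have [] := Hus n.
  apply: (flux_dissipation_limit d_ge1 r01 conv_cont Pmu (rho := rad)).
  - by move=> n; exact: phirho.
  - exact: rH.
  - have h : (fun n => n.+1%:R^-1 : R) @ \oo --> (0 : R).
      apply/cvgrPdist_lt => e e0; near=> n.
      rewrite sub0r normrN ger0_norm ?invr_ge0//.
      by near: n; exact: near_infty_natSinv_lt (PosNum e0).
    apply: (squeeze_cvgr _ (cvg_cst 0) h); apply: nearW => n.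
    by rewrite D0/=; have [_ _ _ /ltW] := Hus n.
split=> // phibar _ _ uniq; apply: is_narrow_cvg_pinfty => t_ nt.
have t0 n : 0 <= t_ n by apply: (le_trans _ (ltW (nt n))).
have [s [mu [ns smu]]] := @bounded_probability_subsequence R d (phi \o t_) rad rad0
  (fun n => phirho _ (t0 n)).
have mulim : omega_limit phi mu.
  by exists (t_ \o s); split => //; exact: cvg_natr_lt.
exists s; split=> // f cf bf.
rewrite (_ : \int[phibar]_x f x = \int[mu]_x f x); first exact: smu.
congr fine; apply: eq_measure_integral => A mA _.
(* The subsequential limit is stationary by the first claim, so uniqueness identifies it with
   [phibar]. *)
by apply: esym; apply: uniq => //; exact: stationary.
Unshelve. all: by end_near. Qed.
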